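(* Let $K$ be a field of characteristic $\neq 2$, let $f\in K[X,Y,Z]$ be an irreducible polynomial of degree $2$, let $\mathcal{X}:=V(f)\subset\mathbb{A}^3_K$, and let $D:=K[X,Y,Z]/(f)$. Then $\dim\mathcal{R}(D)=2$ unless $\mathcal{X}$ is affinely equivalent to $V(XY-1)$, in which case $\dim\mathcal{R}(D)=1$.
   Context: For an integral domain $D$ with quotient field $Q(D)$, the reciprocal complement $\mathcal{R}(D)$ is the subring of $Q(D)$ generated by all $1/x$ with $x\in D\setminus\{0\}$; $\dim$ denotes Krull dimension. $V(f)\subset\mathbb{A}^3_K$ is the affine variety defined by $f$. Affinely equivalent means that an invertible affine change of coordinates over $K$ carries one quadric to the other (i.e. carries the defining polynomial of one to a nonzero scalar multiple of the defining polynomial of the other). *)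

(* Defs.v *)
From HB Require Import structures.
From mathcomp Require Import all_boot all_order all_algebra.
From mathcomp Require Import ring_quotient fraction boolp.
From mathcomp Require Import mpoly.

Set Implicit Arguments.
Unset Strict Implicit.
Unset Printing Implicit Defensive.

Import GRing.Theory.
Local Open Scope ring_scope.
Local Open Scope quotient_scope.

Definition dvd_elt (R : idomainType) (a b : R) : Prop := exists c, b = c * a.

Definition irreducible_elt (R : idomainType) (a : R) : Prop :=
  [/\ a != 0, a \isn't a GRing.unit &
      forall b c, a = b * c -> b \is a GRing.unit \/ c \is a GRing.unit].

Definition prime_elt (R : idomainType) (p : R) : Prop :=
  [/\ p != 0, p \isn't a GRing.unit &
      forall a b, dvd_elt p (a * b) -> dvd_elt p a \/ dvd_elt p b].

(* [ring_quotient] only makes the quotient by a prime ideal a commutative ring;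
   its domain structure is added here, units being decided classically. *)
Section PrimeQuotient.
Variables (R : comNzRingType) (I : prime_idealr R).

Definition pquot_unit : {pred {ideal_quot I}} :=
  [pred x | `[< exists y, y * x = 1 >]].

Definition pquot_inv (x : {ideal_quot I}) : {ideal_quot I} :=
  if pselect (exists y, y * x = 1) is left ex then sval (cid ex) else x.

Lemma pquot_mulVx : {in pquot_unit, left_inverse 1 pquot_inv *%R}.
Proof.
move=> x /asboolP ex; rewrite /pquot_inv; case: pselect => // ex'.
by case: cid.
Qed.

Lemma pquot_unitPl x y : y * x = 1 -> pquot_unit x.
Proof. by move=> yx1; apply/asboolP; exists y. Qed.

Lemma pquot_inv_out : {in [predC pquot_unit], pquot_inv =1 id}.
Proof.
by move=> x /asboolPn nex; rewrite /pquot_inv; case: pselect.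
Qed.

HB.instance Definition _ := GRing.ComNzRing_hasMulInverse.Build {ideal_quot I}
  pquot_mulVx pquot_unitPl pquot_inv_out.

HB.instance Definition _ := GRing.ComUnitRing_isIntegral.Build {ideal_quot I}
  (@Quotient.rquot_IdomainAxiom R I).

End PrimeQuotient.

(* The ideal generated by [p], prime because [p] is. *)
Definition princ_ideal (R : idomainType) (p : R) of prime_elt p : {pred R} :=
  [pred a | `[< dvd_elt p a >]].

Section PrincIdeal.
Variables (R : idomainType) (p : R) (pp : prime_elt p).

Lemma princ_idealP a : reflect (dvd_elt p a) (a \in princ_ideal pp).
Proof. exact: asboolP. Qed.

Lemma princ_ideal_closed : idealr_closed (princ_ideal pp).
Proof.
have [p0 pU _] := pp; split.
- by apply/princ_idealP; exists 0; rewrite mul0r.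
- apply/princ_idealP => -[c c1]; case/negP: pU.
  by apply/unitrPr; exists c; rewrite mulrC.
- move=> a u v /princ_idealP[c ->] /princ_idealP[d ->]; apply/princ_idealP.
  by exists (a * c + d); rewrite mulrDl mulrA.
Qed.

Lemma princ_ideal_prime : prime_idealr_closed (princ_ideal pp).
Proof.
have [_ _ pM] := pp; move=> a b /princ_idealP /pM[] h; apply/orP.
  by left; apply/princ_idealP.
by right; apply/princ_idealP.
Qed.

HB.instance Definition _ :=
  isIdealr.Build R (princ_ideal pp) princ_ideal_closed.
HB.instance Definition _ :=
  isPrimeIdealrClosed.Build R (princ_ideal pp) princ_ideal_prime.

End PrincIdeal.

(* Every nonzero element is a unit times a product of primes.  This is shown
   below for {mpoly K[n]} by Gauss's lemma: an irreducible polynomial then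
   generates a prime ideal, and the quotient by it is an integral domain. *)
Definition factorial_dom (R : idomainType) : Prop := forall a : R, a != 0 ->
  exists u s, [/\ u \is a GRing.unit, forall p, p \in s -> prime_elt p
                & a = u * \prod_(p <- s) p].

Section Factorial.
Variable R : idomainType.
Implicit Types (a b c p u : R) (s : seq R).

Lemma dvd_eltMr p a b : dvd_elt p a -> dvd_elt p (a * b).
Proof. by case=> c ->; exists (c * b); rewrite mulrAC. Qed.

Lemma dvd_eltMl p a b : dvd_elt p b -> dvd_elt p (a * b).
Proof. by rewrite mulrC; apply: dvd_eltMr. Qed.

Lemma prime_elt_unitl u p : u \is a GRing.unit -> prime_elt p ->
  prime_elt (p * u).
Proof.
move=> uU [p0 pU pM]; split.
- by rewrite mulf_neq0 //; apply: contraTneq uU => ->; rewrite unitr0.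
- by rewrite unitrM (negPf pU).
have h a : dvd_elt p a -> dvd_elt (p * u) a.
  by case=> c ->; exists (c / u); rewrite [p * u]mulrC mulrA divrK.
move=> a b [c e]; case: (pM a b); first by
  exists (c * u); rewrite e mulrAC mulrA.
  by move/h; left.
by move/h; right.
Qed.

Lemma factorial_irr_prime a :
  factorial_dom R -> irreducible_elt a -> prime_elt a.
Proof.
move=> fR [a0 aU aI]; have [u [[|p s] [uU sP ae]]] := fR _ a0.
  by rewrite ae big_nil mulr1 uU in aU.
have pP : prime_elt p by apply: sP; rewrite mem_head.
move: ae; rewrite big_cons mulrCA => ae.
rewrite ae; apply: prime_elt_unitl => //.
by case: (aI _ _ ae) => // pU; case: pP => _; rewrite pU.
Qed.

Lemma factor_split s u a b : u \is a GRing.unit ->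
    (forall p, p \in s -> prime_elt p) -> u * \prod_(p <- s) p = a * b ->
  exists ua sa ub sb, [/\ ua \is a GRing.unit, ub \is a GRing.unit,
     a = ua * \prod_(p <- sa) p, b = ub * \prod_(p <- sb) p &
     [/\ forall p, p \in sa -> prime_elt p, forall p, p \in sb -> prime_elt p &
         (size sa + size sb = size s)%N]].
Proof.
elim: s a b => [|p s IH] a b uU sP.
  rewrite big_nil mulr1 => e; move: uU; rewrite e unitrM => /andP[aU bU].
  by exists a, [::], b, [::]; rewrite !big_nil !mulr1.
have pP : prime_elt p by apply: sP; rewrite mem_head.
have sP' q : q \in s -> prime_elt q.
  by move=> qs; apply: sP; rewrite inE qs orbT.
have [p0 _ pM] := pP; rewrite big_cons mulrCA => e.
have cons_prime (t : seq R) : (forall q, q \in t -> prime_elt q) ->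
    forall q, q \in p :: t -> prime_elt q.
  by move=> tP q; rewrite inE => /predU1P[->|/tP].
have /pM[] : dvd_elt p (a * b).
  by rewrite -e; exists (u * \prod_(q <- s) q); rewrite mulrC.
- case=> c ae; rewrite ae mulrAC [RHS]mulrC in e.
  have [ua [sa [ub [sb [uaU ubU ce be [saP sbP ss]]]]]] :=
    IH _ _ uU sP' (mulfI p0 e).
  exists ua, (p :: sa), ub, sb; split => //; last first.
    by split => //; [apply: cons_prime | rewrite /= addSn ss].
  by rewrite ae ce big_cons mulrCA mulrC.
- case=> c be; rewrite be [RHS]mulrA [RHS]mulrC in e.
  have [ua [sa [ub [sb [uaU ubU ae ce [saP sbP ss]]]]]] :=
    IH _ _ uU sP' (mulfI p0 e).
  exists ua, sa, ub, (p :: sb); split => //; last first.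
    by split => //; [apply: cons_prime | rewrite /= addnS ss].
  by rewrite be ce big_cons mulrCA mulrC.
Qed.

End Factorial.

Section FactorialPoly.
Variable R : idomainType.
Implicit Types (c p : R) (f g h q : {poly R}).

Lemma dvd_polyC p f : (forall i, dvd_elt p f`_i) <-> dvd_elt p%:P f.
Proof.
split=> [pf|[g ->] i]; last by exists g`_i; rewrite coefMC.
have [c cE] := choice pf.
exists (\poly_(i < size f) c i); apply/polyP => i; rewrite coefMC coef_poly.
by by case: ltnP => [_|le]; [exact: cE | rewrite mul0r nth_default].
Qed.

Lemma prime_polyC p : prime_elt p -> prime_elt p%:P.
Proof.
move=> pp; have [p0 pU pM] := pp; split; first by rewrite polyC_eq0.
  by rewrite poly_unitE coefC eqxx (negPf pU) andbF.
pose Q := {ideal_quot princ_ideal pp}; pose phi := map_poly (\pi_Q : R -> Q).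
have phi0 f : phi f = 0 <-> dvd_elt p%:P f.
  rewrite -dvd_polyC; split=> [f0 i|pf].
    apply/(princ_idealP pp); rewrite -[f`_i]subr0 Quotient.idealrBE.
    by rewrite -coef_map -/phi f0 coef0 raddf0.
  apply/polyP => i; rewrite coef_map coef0 -(rmorph0 (\pi_Q : R -> Q)) /=.
  by apply/eqP; rewrite -Quotient.idealrBE subr0; apply/princ_idealP.
move=> g h /phi0 /eqP; rewrite /phi rmorphM mulf_eq0 => /orP[] /eqP /phi0.
  by left.
by right.
Qed.

Hypothesis fR : factorial_dom R.

Lemma primitive_dvd c f h q : (forall p, prime_elt p -> ~ dvd_elt p%:P f) ->
  c != 0 -> c *: h = q * f -> dvd_elt f h.
Proof.
move=> fP c0; have [u [s [uU sP ->]]] := fR c0.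
elim: s sP q => [|p s IH] sP q.
  rewrite big_nil mulr1 => e; exists (u^-1 *: q).
  by rewrite -scalerAl -e scalerA mulVr // scale1r.
have pP : prime_elt p by apply: sP; rewrite mem_head.
have [p0 _ pM] := prime_polyC pP.
rewrite big_cons mulrCA -scalerA -mul_polyC => e.
have /pM[|/(fP _ pP)//] : dvd_elt p%:P (q * f).
  by rewrite -e; apply: dvd_eltMr; exists 1; rewrite mul1r.
case=> k ke; move: e; rewrite ke mulrAC [RHS]mulrC => /(mulfI p0).
by apply: IH => r rs; apply: sP; rewrite inE rs orbT.
Qed.

Lemma clear_denom c f q g : c != 0 -> c *: f = q * g ->
  exists q' g' a b, [/\ a != 0, b != 0, q = a *: q', g = b *: g' & f = q' * g'].
Proof.
move=> c0; have [u [s [uU sP ->]]] := fR c0.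
elim: s sP q g => [|p s IH] sP q g.
  rewrite big_nil mulr1 => e; exists (u^-1 *: q), g, u, 1.
  rewrite oner_neq0 scale1r scalerA divrr // scale1r; split => //.
    by apply: contraTneq uU => ->; rewrite unitr0.
  by rewrite -scalerAl -e scalerA mulVr // scale1r.
have pP : prime_elt p by apply: sP; rewrite mem_head.
have [p0 _ pM] := prime_polyC pP; have pn0 : p != 0 by case: pP.
have sP' r : r \in s -> prime_elt r.
  by move=> rs; apply: sP; rewrite inE rs orbT.
rewrite big_cons mulrCA -[(p * _) *: _]scalerA -[p *: _]mul_polyC => e.
have /pM[] : dvd_elt p%:P (q * g).
  by rewrite -e; apply: dvd_eltMr; exists 1; rewrite mul1r.
- case=> k ke; rewrite ke mulrAC [RHS]mulrC in e.
  have [q' [g' [a [b [a0 b0 ka gb fe]]]]] := IH sP' _ _ (mulfI p0 e).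
  exists q', g', (p * a), b; split => //; first by rewrite mulf_neq0.
  by rewrite ke ka mulrC mul_polyC scalerA.
- case=> k ke; rewrite ke [RHS]mulrA [RHS]mulrC in e.
  have [q' [g' [a [b [a0 b0 ka gb fe]]]]] := IH sP' _ _ (mulfI p0 e).
  exists q', g', a, (p * b); split => //; first by rewrite mulf_neq0.
  by rewrite ke gb mulrC mul_polyC scalerA.
Qed.

Lemma unit_polyC c : (c%:P \is a GRing.unit) = (c \is a GRing.unit).
Proof.
rewrite poly_unitE coefC eqxx size_polyC.
by have [->|] := eqVneq c 0; rewrite ?unitr0 ?andbF.
Qed.

Lemma poly_irr_prime f : irreducible_elt f -> prime_elt f.
Proof.
move=> fI; have [f0 fU fM] := fI.
have [/size_poly1P[c c0 fc]|f1] := boolP (size f == 1%N).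
  rewrite fc; apply: prime_polyC; apply: factorial_irr_prime => //.
  split=> // [|a b e]; first by rewrite fc unit_polyC in fU.
  by rewrite -!unit_polyC; apply: fM; rewrite fc e polyCM.
have fP p : prime_elt p -> ~ dvd_elt p%:P f.
  move=> [p0 pU _] [g fg]; case: (fM _ _ fg); last first.
    by rewrite unit_polyC (negPf pU).
  rewrite poly_unitE => /andP[/eqP g1 _]; case/eqP: f1.
  by rewrite fg mulrC mul_polyC size_scale.
split=> // g h [k e].
have [[c q] /= c0 fq] := Pdiv.Idomain.dvdpP _ _ (dvdp_gcdl f g).
have [q' [d' [a [b [a0 b0 _ db fqd]]]]] := clear_denom c0 fq.
case: (fM _ _ fqd) => [q'U|].
- left; have [[c' k'] /= c'0 gk] := Pdiv.Idomain.dvdpP _ _ (dvdp_gcdr f g).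
  apply: (primitive_dvd (c := c') (q := (b *: k') * q'^-1) fP c'0).
  by rewrite gk db fqd [RHS]mulrA divrK // -scalerAl scalerAr.
- rewrite poly_unitE => /andP[d1 _]; right.
  have cop : coprimep f g by rewrite coprimep_def db size_scale.
  have : f %| g * h.
    apply/Pdiv.Idomain.dvdpP.
    by exists (1, k); rewrite ?oner_neq0 //= scale1r.
  rewrite (Gauss_dvdpr _ cop) => /Pdiv.Idomain.dvdpP[[c' k'] /= c'0 hk].
  exact: primitive_dvd hk.
Qed.

Lemma factorial_poly : factorial_dom {poly R}.
Proof.
suff H n : forall g u (s : seq R), g != 0 -> u \is a GRing.unit ->
    (forall p, p \in s -> prime_elt p) -> lead_coef g = u * \prod_(p <- s) p ->
    (size g + size s <= n)%N ->
  exists u' (s' : seq {poly R}), [/\ u' \is a GRing.unit,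
      forall q, q \in s' -> prime_elt q & g = u' * \prod_(q <- s') q].
  move=> g g0; have [|u [s [uU sP e]]] := fR (a := lead_coef g).
    by rewrite lead_coef_eq0.
  exact: (H _ g u s g0 uU sP e (leqnn _)).
elim: n => [|n IH] g u s g0 uU sP e.
  by rewrite leqn0 addn_eq0 size_poly_eq0 (negPf g0).
move=> le.
have [gU|gU] := boolP (g \is a GRing.unit).
  by exists g, [::]; rewrite big_nil mulr1.
have [gI|gI] := pselect (irreducible_elt g).
  exists 1, [:: g]; rewrite unitr1 big_seq1 mul1r; split => // q.
  by rewrite inE => /eqP ->; apply: poly_irr_prime.
have [a [b [gab aU bU]]] : exists a b,
    [/\ g = a * b, a \isn't a GRing.unit & b \isn't a GRing.unit].
  apply: contrapT => hn; apply: gI; split=> // a b gab.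
  case: (boolP (a \is a GRing.unit)) => aU; first by left.
  case: (boolP (b \is a GRing.unit)) => bU; first by right.
  by case: hn; exists a, b.
have /andP[a0 b0] : (a != 0) && (b != 0) by rewrite -negb_or -mulf_eq0 -gab.
have [|ua [sa [ub [sb [uaU ubU ae be [saP sbP ss]]]]]] :=
  factor_split (a := lead_coef a) (b := lead_coef b) uU sP.
  by rewrite -e gab lead_coefM.
have pos (k : {poly R}) v t : k != 0 -> k \isn't a GRing.unit ->
    v \is a GRing.unit ->
    lead_coef k = v * \prod_(p <- t) p -> (1 < size k + size t)%N.
  move=> k0 kU vU ke; have := k0; rewrite -size_poly_gt0 leq_eqVlt.
  case/predU1P => [k1|k2]; last exact: leq_trans k2 (leq_addr _ _).
  rewrite -k1 add1n ltnS lt0n; apply: contraNneq kU => /eqP/nilP t0.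
  move: ke; rewrite t0 big_nil mulr1 lead_coefE -k1 => ke.
  by rewrite poly_unitE -k1 eqxx ke.
have pa := pos a ua sa a0 aU uaU ae; have pb := pos b ub sb b0 bU ubU be.
have sg : (size g).+1 = (size a + size b)%N.
  by rewrite gab size_mul // prednK // addn_gt0 size_poly_gt0 a0.
have tot : ((size a + size sa) + (size b + size sb) = (size g + size s).+1)%N.
  by rewrite addnACA -sg ss.
have bnd x y : (1 < y -> x + y = (size g + size s).+1 -> x <= n)%N.
  move=> y1 xy; have : (x + 2 <= n.+2)%N.
    by rewrite (leq_trans (n := (x + y)%N)) ?leq_add2l // xy ltnS.
  by rewrite addn2 !ltnS.
have [|u1 [s1 [u1U s1P e1]]] := IH a ua sa a0 uaU saP ae.
  exact: bnd pb tot.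
have [|u2 [s2 [u2U s2P e2]]] := IH b ub sb b0 ubU sbP be.
  by apply: bnd pa _; rewrite addnC.
exists (u1 * u2), (s1 ++ s2); split; first by rewrite unitrM u1U.
  by move=> q; rewrite mem_cat => /orP[/s1P|/s2P].
by rewrite gab e1 e2 big_cat /= mulrACA.
Qed.

End FactorialPoly.

Lemma factorial_iso (R S : idomainType) (phi : {rmorphism R -> S})
    (psi : {rmorphism S -> R}) :
  cancel phi psi -> cancel psi phi -> factorial_dom R -> factorial_dom S.
Proof.
move=> phiK psiK fR a a0.
have [|u [s [uU sP ae]]] := fR (psi a).
  by rewrite -(rmorph0 psi) (can_eq psiK).
exists (phi u), (map phi s); split; first exact: rmorph_unit.
  move=> _ /mapP[p /sP[p0 pU pM] ->]; split.
  - by rewrite -(rmorph0 phi) (can_eq phiK).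
  - by apply: contraNN pU => /(rmorph_unit psi); rewrite phiK.
  move=> b c [d /(congr1 psi)]; rewrite !rmorphM phiK => e.
  have [|[k ke]|[k ke]] := pM (psi b) (psi c); first by exists (psi d).
    by left; exists (phi k); rewrite -rmorphM -ke psiK.
  by right; exists (phi k); rewrite -rmorphM -ke psiK.
by rewrite -[a]psiK ae rmorphM rmorph_prod big_map.
Qed.

Section FactorialMPoly.
Variable K : fieldType.

Section Multi.
Variable n : nat.
Definition mpoly_of_poly : {poly {mpoly K[n]}} -> {mpoly K[n.+1]} :=
  horner_eval ('X_ord_max : {mpoly K[n.+1]}) \o map_poly (@mwiden n K).

HB.instance Definition _ := GRing.RMorphism.on mpoly_of_poly.

Lemma muniX m : muni 'X_[m] =
  'X_[[multinom m (widen_ord (leqnSn n) i) | i < n]] *: 'X^(m ord_max)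
    :> {poly {mpoly K[n]}}.
Proof. by rewrite muniE msuppX big_seq1 mcoeffX eqxx scale1r. Qed.

Lemma mpoly_of_polyZ (c : {mpoly K[n]}) k :
  mpoly_of_poly (c *: 'X^k) = mwiden c * 'X_ord_max ^+ k.
Proof.
have fC : mpoly_of_poly c%:P = mwiden c.
  by rewrite /mpoly_of_poly /= /horner_eval map_polyC hornerC.
have fX : mpoly_of_poly 'X = 'X_ord_max.
  by rewrite /mpoly_of_poly /= /horner_eval map_polyX hornerX.
by rewrite -mul_polyC rmorphM rmorphXn /= fC fX.
Qed.

Lemma muniK : cancel (@muni n K) mpoly_of_poly.
Proof.
move=> p; rewrite muniE {3}[p]mpolyE (raddf_sum mpoly_of_poly).
apply: eq_bigr => m _.
rewrite [LHS]mpoly_of_polyZ mwidenZ mwidenX -scalerAl mpolyXn -mpolyXD.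
congr (_ *: 'X_[_]); apply/mnmP => i; rewrite mnmDE mulmnE mnm1E.
have [<-|ni] := eqVneq ord_max i; first by rewrite mnmwiden_ordmax add0n mul1n.
have lt : (i < n)%N.
  rewrite ltn_neqAle -ltnS ltn_ord andbT.
  by apply: contra_neq ni => e; apply: val_inj.
have -> : i = widen_ord (leqnSn n) (Ordinal lt) by apply: val_inj.
by rewrite mnmwiden_widen mnmE addn0.
Qed.

Lemma mmultiK : cancel mpoly_of_poly (@muni n K).
Proof.
have mwiden_muni (c : {mpoly K[n]}) : muni (mwiden c) = c%:P.
  rewrite [c]mpolyE (raddf_sum (@mwiden n K)) (raddf_sum (@muni n K)).
  rewrite (raddf_sum (@polyC {mpoly K[n]})).
  apply: eq_bigr => m _ /=.
  rewrite mwidenZ mwidenX muniZ muniX mnmwiden_ordmax expr0 alg_polyC.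
  rewrite -mul_mpolyC polyCM mul_polyC.
  congr (_ *: 'X_[_]%:P); apply/mnmP => i.
  by rewrite mnmE mnmwiden_widen.
move=> q; rewrite -{1}[q]coefK poly_def (raddf_sum mpoly_of_poly) raddf_sum.
rewrite -[RHS]coefK poly_def; apply: eq_bigr => i _.
transitivity (muni (mwiden q`_i * ('X_ord_max : {mpoly K[n.+1]}) ^+ i)).
  by congr muni; apply: mpoly_of_polyZ.
rewrite muniM mwiden_muni rmorphXn /= muniX.
rewrite mnm1E eqxx expr1 mul_polyC.
have -> : [multinom (U_(ord_max) (widen_ord (leqnSn n) j))%MM | j < n] = 0%MM.
  apply/mnmP => j; rewrite !mnmE; case: eqP => // /(congr1 val) /= e.
  by have := ltn_ord j; rewrite -e ltnn.
by rewrite mpolyX0 scale1r.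
Qed.
End Multi.

Lemma factorial_mpoly n : factorial_dom {mpoly K[n]}.
Proof.
elim: n => [|n IH].
  move=> a a0; exists a, [::]; rewrite big_nil mulr1; split => //.
  have aE : a = (a@_0)%:MP.
    apply/mpolyP => m; have -> : m = 0%MM by apply/mnmP; case.
    by rewrite mcoeffC eqxx mulr1.
  have c0 : a@_0 != 0 by apply: contraNneq a0 => c0; rewrite aE c0.
  apply/unitrPr; exists (a@_0)^-1%:MP.
  by rewrite {1}aE -mpolyCM divff.
exact: factorial_iso (@mmultiK n) (@muniK n) (factorial_poly IH).
Qed.

End FactorialMPoly.

Section CoordinateRing.
Variables (n : nat) (K : fieldType) (f : {mpoly K[n]}).

Lemma mpoly_irr_prime : irreducible_elt f -> prime_elt f.
Proof. exact: factorial_irr_prime (@factorial_mpoly K n). Qed.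

(* K[X_1, ..., X_n]/(f) *)
Definition coord_ring (f_irr : irreducible_elt f) : idomainType :=
  {ideal_quot princ_ideal (mpoly_irr_prime f_irr)}.

End CoordinateRing.

Section Recip.
Variable D : idomainType.

(* Smallest subring of the fraction field containing the 1/x with x nonzero. *)
Definition recip_pred : {pred {fraction D}} :=
  [pred y | `[< forall S : {pred {fraction D}}, subring_closed S ->
       (forall x : D, x != 0 -> (FracField.tofrac x)^-1 \in S) -> y \in S >]].

Lemma recip_subring : subring_closed recip_pred.
Proof.
split.
- by apply/asboolP => S [].
- move=> x y /asboolP hx /asboolP hy; apply/asboolP => S hS hi.
  by case: (hS) => _ hB _; apply: hB; [apply: hx|apply: hy].
- move=> x y /asboolP hx /asboolP hy; apply/asboolP => S hS hi.
  by case: (hS) => _ _ hM; apply: hM; [apply: hx|apply: hy].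
Qed.

HB.instance Definition _ :=
  GRing.isSubringClosed.Build {fraction D} recip_pred recip_subring.

Definition recip_complement : Type := {y : {fraction D} | y \in recip_pred}.

HB.instance Definition _ := SubChoice.on recip_complement.
HB.instance Definition _ :=
  [SubChoice_isSubComNzRing of recip_complement by <:].

End Recip.

(* A chain P_0 < ... < P_d of d + 1 prime ideals. *)
Definition prime_chain (R : comNzRingType) (d : nat) : Prop :=
  exists P : 'I_d.+1 -> prime_idealr R,
    forall i j : 'I_d.+1, (i < j)%N ->
      {subset P i <= P j} /\ ~ {subset P j <= P i}.

Definition krull_dim_is (R : comNzRingType) (d : nat) : Prop :=
  prime_chain R d /\ forall e, prime_chain R e -> (e <= d)%N.

Definition affine_forms (n : nat) (K : fieldType) (A : 'M[K]_n) (b : 'cV[K]_n) :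
    n.-tuple {mpoly K[n]} :=
  [tuple (\sum_(j < n) A i j *: 'X_j) + (b i 0)%:MP | i < n].

(* The affine change of coordinates x |-> A x + b carries f to a nonzero scalar
   multiple of g. *)
Definition affinely_equivalent (n : nat) (K : fieldType) (f g : {mpoly K[n]}) :
    Prop :=
  exists (A : 'M[K]_n) (b : 'cV[K]_n) (c : K),
    [/\ A \in unitmx, c != 0 & f \mPo affine_forms A b = c *: g].

(* XY - 1 in K[X, Y, Z] *)
Definition XY_sub_1 (K : fieldType) : {mpoly K[3]} :=
  'X_(inord 0) * 'X_(inord 1) - 1.

(* Main.v *)
Require Import Defs.
From HB Require Import structures.
From mathcomp Require Import all_boot all_order all_algebra.
From mathcomp Require Import perm ring_quotient fraction boolp mpoly.
From mathcomp Require Import ring zify.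

(** Comparing degrees is the mechanism.  A dominance on a domain [D] is a total
preorder, compatible with products and differences, in which every nonzero
element is at least [1].  Every element of the reciprocal complement of [D] is
then a fraction [a / b] with [a] bounded by [b], and the fractions with [a]
strictly below [b] form a prime ideal.  Finer and finer dominances give larger
and larger prime ideals ([prime_chain_dom]), so lower bounds on the dimension
come from nested dominances.

Completing a square brings an irreducible quadric to the shape
[Z ^+ 2 = h(X, Y)], so that [D] is free with basis [1, z] over [A = K[X][Y]],
with norm [p ^+ 2 - h * q ^+ 2].  A comparison of polynomials of [A] transfers
to [D] through the norm as soon as the leading terms of [p ^+ 2] and
[h * q ^+ 2] never cancel ([norm_dominance]).  For the comparison by degree in
[Y], refined by the degree in [X] of the leading coefficient, this happens when
the leading exponents of [h] are not all even, or when its leading coefficient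
is not a square in [K] ([norm_dom_poly]).  The three nested dominances (being
zero or not, degree in [Y], lexicographic degree) then give a chain of three
primes ([prime_chain2]).

Up to affine changes of coordinates every irreducible quadric has such an
equation, or else is [XY = 1] ([classify]).  If the coefficient of [Y ^+ 2] in
[h] is a nonzero square, the equation can be rewritten as
[V * W = c * X ^+ 2 + l * X + k].  When [c] is nonzero one solves for [X ^+ 2]
instead, with a right-hand side linear in [V]; when [c] vanishes but [l] does
not, [h] is linear in [X]; and when both vanish the quadric is reducible or is
[XY = 1].

For the upper bound, any three elements of the fraction field of [D] are
algebraically dependent over [K], by counting monomials ([recip_dep]).  Along a
chain of four primes, choose elements separating consecutive primes and take
lowest nonzero coefficients of their dependence relation one variable after the
other: a nonzero scalar falls into the largest prime ([chain_bound2]).  For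
[XY = 1], both factors of [v * u = 1] are reciprocals, so the nonzero
polynomials in [u] are units of the reciprocal complement; the dependence
between [u] and two further elements forbids a chain of three primes
([krull_dim1]), and the degree along the cylinder gives a chain of two. *)

Set Implicit Arguments.
Unset Strict Implicit.
Unset Printing Implicit Defensive.

Import GRing.Theory.
Local Open Scope ring_scope.
Local Open Scope quotient_scope.

(** * Dominances and prime ideals of the reciprocal complement *)

(** Preorders [a <= b] read as [a] being bounded by [b] at some place of the
fraction field: the place is centred at infinity, since every nonzero element
of [D] dominates [1]. *)
Record dominance (D : idomainType) (le : rel D) : Prop := Dominance {
  dom_total : total le;
  dom_trans : transitive le;
  dom_mul : forall c a b, c != 0 -> le (a * c) (b * c) = le a b;
  dom_sub : forall a b c, le a c -> le b c -> le (a - b) c;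
  dom_10 : ~~ le 1 0;
  dom_1 : forall a, a != 0 -> le 1 a }.

Arguments dom_trans {D le} _ {y x z}.
Arguments dom_mul {D le} _ {c a b}.
Arguments dom_sub {D le} _ {a b c}.
Arguments dom_1 {D le} _ {a}.

Section DominanceTheory.
Variables (D : idomainType) (le : rel D) (leP : dominance le).
Local Notation "x %:F" := (FracField.tofrac x).

Lemma dom_refl a : le a a.
Proof. by have := dom_total leP a a; rewrite orbb. Qed.

Lemma dom_0 a : le 0 a.
Proof. by rewrite -(subrr a); apply: (dom_sub leP); apply: dom_refl. Qed.

Lemma dom_le0 a : a != 0 -> ~~ le a 0.
Proof.
move=> a0; apply: contra (dom_10 leP).
exact: (dom_trans leP) (dom_1 leP a0).
Qed.

Lemma dom_0P a : reflect (a = 0) (le a 0).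
Proof.
apply: (iffP idP) => [|->]; last exact: dom_refl.
by apply: contraTeq => /dom_le0.
Qed.

Lemma dom_opp a c : le a c -> le (- a) c.
Proof. by move=> ac; rewrite -sub0r; apply: (dom_sub leP) => //; apply: dom_0. Qed.

Lemma dom_add a b c : le a c -> le b c -> le (a + b) c.
Proof. by move=> ac bc; rewrite -[b]opprK; apply: (dom_sub leP) => //; apply: dom_opp. Qed.

Lemma dom_mul2 a b c d : le a b -> le c d -> le (a * c) (b * d).
Proof.
move=> ab cd; have [->|c0] := eqVneq c 0; first by rewrite mulr0 dom_0.
have [b0|b0] := eqVneq b 0.
  by move: ab; rewrite b0 => /dom_0P ->; rewrite mul0r dom_0.
by apply: (@dom_trans _ _ leP (b * c)); rewrite ?(dom_mul leP) // ![b * _]mulrC (dom_mul leP).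
Qed.

Lemma dom_add_lt a b c : ~~ le c a -> ~~ le c b -> ~~ le c (a + b).
Proof.
wlog ab : a b / le a b => [h ca cb|ca cb].
  by case/orP: (dom_total leP a b) => /h; [|rewrite addrC]; apply.
apply: contra cb => cab; apply: (dom_trans leP) cab _.
by apply: dom_add => //; apply: dom_refl.
Qed.

Lemma dom_frac_eq a b c d : b != 0 -> d != 0 -> a%:F / b%:F = c%:F / d%:F ->
  le b a = le d c.
Proof.
move=> b0 d0 /eqP.
rewrite eqr_div ?tofrac_eq0 // -!tofracM tofrac_eq => /eqP e.
by rewrite -(dom_mul leP d0) e [b * d]mulrC (dom_mul leP b0).
Qed.

(** The fractions [a / b] with [a] bounded by [b] form a ring, and it contains
the reciprocals of the nonzero elements of [D]. *)
Lemma recip_dom (y : {fraction D}) : y \in @recip_pred D ->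
  exists a b, [/\ b != 0, y = a%:F / b%:F & le a b].
Proof.
pose V : {pred {fraction D}} :=
  [pred y | `[< exists a b, [/\ b != 0, y = a%:F / b%:F & le a b] >]].
move/asboolP => /(_ V) h; apply/asboolP/h => [|x x0]; last first.
  by apply/asboolP; exists 1, x; rewrite tofrac1 mul1r (dom_1 leP).
split.
- apply/asboolP; exists 1, 1.
  by rewrite oner_neq0 tofrac1 divr1 dom_refl.
- move=> _ _ /asboolP[a [b [b0 -> ab]]] /asboolP[c [d [d0 -> cd]]].
  apply/asboolP; exists (a * d - c * b), (b * d); split.
  + by rewrite mulf_neq0.
  + by rewrite -mulNr addf_div ?tofrac_eq0 // tofracB !tofracM mulNr.
  + by rewrite (dom_sub leP) ?(dom_mul leP) // [b * d]mulrC (dom_mul leP).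
- move=> _ _ /asboolP[a [b [b0 -> ab]]] /asboolP[c [d [d0 -> cd]]].
  apply/asboolP; exists (a * c), (b * d); split.
  + by rewrite mulf_neq0.
  + by rewrite mulf_div !tofracM.
  + exact: dom_mul2.
Qed.

End DominanceTheory.

Section DominancePrime.
Variables (D : idomainType) (le : rel D) (leP : dominance le).
Local Notation R := (recip_complement D).
Local Notation "x %:F" := (FracField.tofrac x).

(** The infinitesimal elements of the reciprocal complement; the condition does
not depend on the fraction chosen by [dom_frac_eq]. *)
Definition dom_ideal of dominance le : {pred R} :=
  [pred r : R | `[< exists a b, [/\ b != 0, val r = a%:F / b%:F & ~~ le b a] >]].

Lemma dom_idealE (r : R) a b : b != 0 -> val r = a%:F / b%:F ->
  (r \in dom_ideal leP) = ~~ le b a.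
Proof.
move=> b0 e; apply/asboolP/idP => [[c [d [d0 e' dc]]]|ba]; last by exists a, b.
by rewrite (@dom_frac_eq _ _ leP a b c d) // -e.
Qed.

Lemma dom_ideal_closed : idealr_closed (dom_ideal leP).
Proof.
split.
- rewrite (dom_idealE (oner_neq0 _) (a := 0)) ?(dom_10 leP) //.
  by rewrite tofrac0 mul0r.
- rewrite (dom_idealE (oner_neq0 _) (a := 1)) ?(dom_refl leP) //.
  by rewrite tofrac1 divr1.
move=> r u v.
have [a [b [b0 ea ab]]] := recip_dom leP (valP r).
move=> /asboolP[c [d [d0 ec cd]]] /asboolP[e [g [g0 ee eg]]].
rewrite (@dom_idealE _ (a * c * g + e * (b * d)) ((b * d) * g)); last first.
- by rewrite rmorphD rmorphM /= ea ec ee mulf_div addf_div ?mulf_neq0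
     ?tofrac_eq0 // tofracD !tofracM.
- by rewrite !mulf_neq0.
apply: (dom_add_lt leP); last by rewrite [b * d * g]mulrC (dom_mul leP) ?mulf_neq0.
rewrite (dom_mul leP) //; apply: contra cd => h.
rewrite -(dom_mul leP b0) mulrC [c * b]mulrC; apply: (dom_trans leP) h _.
by apply: (dom_mul2 leP) => //; apply: (dom_refl leP).
Qed.

Lemma dom_ideal_prime : prime_idealr_closed (dom_ideal leP).
Proof.
move=> r s.
have [a [b [b0 ea ab]]] := recip_dom leP (valP r).
have [c [d [d0 ec cd]]] := recip_dom leP (valP s).
rewrite (@dom_idealE _ (a * c) (b * d)) ?mulf_neq0 //; last first.
  by rewrite rmorphM /= ea ec mulf_div !tofracM.
rewrite (dom_idealE b0 ea) (dom_idealE d0 ec); apply: contraR.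
by rewrite negb_or !negbK => /andP[? ?]; apply: (dom_mul2 leP).
Qed.

HB.instance Definition _ := isIdealr.Build R (dom_ideal leP) dom_ideal_closed.
HB.instance Definition _ :=
  isPrimeIdealrClosed.Build R (dom_ideal leP) dom_ideal_prime.

End DominancePrime.

Section RecipElements.
Variable D : idomainType.
Local Notation R := (recip_complement D).
Local Notation "x %:F" := (FracField.tofrac x).

Lemma recip_inv_mem (x : D) : x != 0 -> (x%:F)^-1 \in @recip_pred D.
Proof. by move=> x0; apply/asboolP => S _; apply. Qed.

Definition recip_inv (x : D) (x0 : x != 0) : R := Sub (x%:F)^-1 (recip_inv_mem x0).

Lemma recip_inv_dom le (leP : dominance le) (x : D) (x0 : x != 0) :
  (recip_inv x0 \in dom_ideal leP) = ~~ le x 1.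
Proof. by rewrite (@dom_idealE _ _ _ _ 1 x) //= tofrac1 mul1r. Qed.

(** A finer dominance has more infinitesimals.  The reciprocal of [x] separates
two of the ideals when [x] is bounded for one dominance but not for the
other. *)
Lemma prime_chain_dom (d : nat) (le : 'I_d.+1 -> rel D) :
    (forall i, dominance (le i)) ->
    (forall i j : 'I_d.+1, (i < j)%N -> subrel (le j) (le i)) ->
    (forall i j : 'I_d.+1, (i < j)%N -> exists x, [/\ x != 0, le i x 1 & ~~ le j x 1]) ->
  prime_chain R d.
Proof.
move=> leP sub strict.
exists (fun i => dom_ideal (leP i) : prime_idealr R) => i j ij; split.
  move=> r /asboolP[a [b [b0 e ba]]]; apply/asboolP; exists a, b; split=> //.
  by apply: contra ba; apply: sub.
have [x [x0 xi xj]] := strict i j ij.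
by move=> /(_ (recip_inv x0)); rewrite !recip_inv_dom xi xj => /(_ isT).
Qed.
End RecipElements.

(** * Dominances on polynomial rings *)

(** The coarsest dominance: its infinitesimals reduce to [0]. *)
Definition triv_le (R : idomainType) : rel R := fun a b => (a == 0) || (b != 0).

Lemma triv_dominance (R : idomainType) : dominance (@triv_le R).
Proof.
split=> [a b|b a c|c a b c0|a b c||a a0]; rewrite /triv_le.
- by case: eqP; case: eqP.
- by case: eqP => //= _; case: eqP.
- by rewrite !mulf_eq0 (negPf c0) !orbF.
- by case: (c =P 0) => _ /=; rewrite ?orbT // !orbF => /eqP -> /eqP ->; rewrite subr0.
- by rewrite oner_eq0 eqxx.
- by rewrite a0 orbT.
Qed.

(** Degree first, then [le] on leading coefficients.  Reading the coefficient of
[p] at the degree of [r] makes compatibility with differences a property of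
coefficients. *)
Definition poly_le (R : idomainType) (le : rel R) : rel {poly R} := fun p r =>
  (size p <= size r)%N && le p`_(size r).-1 (lead_coef r).

Section PolyDominance.
Variables (R : idomainType) (le : rel R) (leP : dominance le).
Implicit Types p q r : {poly R}.

Lemma poly_le_lt p r : (size p < size r)%N -> poly_le le p r.
Proof.
move=> h; rewrite /poly_le ltnW // nth_default ?(dom_0 leP) //.
by case: (size r) h.
Qed.

Lemma poly_le_eq p r : size p = size r ->
  poly_le le p r = le (lead_coef p) (lead_coef r).
Proof. by move=> h; rewrite /poly_le h leqnn /= -h. Qed.

Lemma poly_le_gt p r : (size r < size p)%N -> poly_le le p r = false.
Proof. by move=> h; rewrite /poly_le leqNgt h. Qed.

Lemma poly_dominance : dominance (poly_le le).
Proof.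
split=> [p q|q p r|c p q c0|p q r||p p0].
- case: (ltngtP (size p) (size q)) => [h|h|h]; first by rewrite poly_le_lt.
    by rewrite (poly_le_lt h) orbT.
  by rewrite !poly_le_eq // (dom_total leP).
- case/andP=> pq lpq /andP[qr lqr]; rewrite /poly_le (leq_trans pq qr) /=.
  move: qr; rewrite leq_eqVlt => /orP[/eqP qr|qr].
    by rewrite -qr in lqr *; apply: (dom_trans leP) lqr.
  rewrite nth_default ?(dom_0 leP) //.
  by rewrite (leq_trans pq) //; case: (size r) qr.
- have [->|p0] := eqVneq p 0.
    by rewrite mul0r /poly_le size_poly0 !coef0 !(dom_0 leP).
  have [->|q0] := eqVneq q 0.
    by rewrite mul0r !poly_le_gt // ?size_poly0 ?size_poly_gt0 ?mulf_neq0.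
  have cg : (0 < size c)%N by rewrite size_poly_gt0.
  have pg : (0 < size p)%N by rewrite size_poly_gt0.
  have qg : (0 < size q)%N by rewrite size_poly_gt0.
  case: (ltngtP (size p) (size q)) => h.
  + by rewrite !poly_le_lt // !size_mul //; lia.
  + by rewrite !poly_le_gt // !size_mul //; lia.
  + rewrite !poly_le_eq // ?size_mul ?h // !lead_coefM (dom_mul leP) //.
    by rewrite lead_coef_eq0.
- case/andP=> pr lpr /andP[qr lqr]; rewrite /poly_le.
  rewrite (leq_trans (size_polyD _ _)) ?size_polyN ?geq_max ?pr //=.
  by rewrite coefB (dom_sub leP).
- by rewrite poly_le_gt // size_poly0 size_poly1.
- have : (0 < size p)%N by rewrite size_poly_gt0.
  rewrite leq_eqVlt => /orP[/eqP p1|p1]; last first.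
    by rewrite poly_le_lt ?size_poly1.
  rewrite poly_le_eq ?size_poly1 // lead_coef1 (dom_1 leP) //.
  by rewrite lead_coef_eq0.
Qed.

End PolyDominance.

(** The terms [p ^+ 2] and [h * q ^+ 2] do not cancel, as far as [le] can see,
in the norm of [p + q z] where [z ^+ 2 = h]. *)
Definition norm_dom (R : idomainType) (le : rel R) (h : R) :=
  forall p q, le (p ^+ 2) (p ^+ 2 - h * q ^+ 2).

Lemma norm_dom_triv (R : idomainType) (h : R) :
  (forall p q, p ^+ 2 = h * q ^+ 2 -> p = 0) -> norm_dom (@triv_le R) h.
Proof.
move=> hP p q; rewrite /triv_le; have [->|] := eqVneq p 0.
  by rewrite expr0n eqxx.
apply: contraR; rewrite negb_or negbK subr_eq0 => /andP[_ /eqP /hP ->].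
exact: eqxx.
Qed.

(** If [h] has odd degree, the degrees of [p ^+ 2] and [h * q ^+ 2] have
different parities.  Otherwise the leading coefficient of the difference, when
the degrees agree, is the same expression for the leading coefficients, to
which the hypothesis applies. *)
Lemma norm_dom_poly (R : idomainType) (le : rel R) (h : {poly R}) :
  dominance le -> (odd (size h) -> norm_dom le (lead_coef h)) ->
  norm_dom (poly_le le) h.
Proof.
move=> leP hP p q; have leP' := poly_dominance leP.
have [->|h0] := eqVneq h 0; first by rewrite mul0r subr0 (dom_refl leP').
have [->|p0] := eqVneq p 0; first by rewrite expr0n (dom_0 leP').
have [->|q0] := eqVneq q 0.
  by rewrite expr0n mulr0 subr0 (dom_refl leP').
have pg : (0 < size p)%N by rewrite size_poly_gt0.
have qg : (0 < size q)%N by rewrite size_poly_gt0.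
have hg : (0 < size h)%N by rewrite size_poly_gt0.
have sq (r : {poly R}) : r != 0 -> size (r ^+ 2) = (size r + size r).-1.
  by move=> r0; rewrite expr2 size_mul.
have sp := sq _ p0; have sh : size (h * q ^+ 2) = (size h + size q + size q).-2.
  by rewrite size_mul ?expf_neq0 // sq //; lia.
case: (ltngtP (size (h * q ^+ 2)) (size (p ^+ 2))) => s.
- have s' : size (p ^+ 2 - h * q ^+ 2) = size (p ^+ 2).
    by rewrite size_polyDl // size_polyN.
  rewrite (poly_le_eq _ (esym s')) // lead_coefDl ?size_polyN //.
  exact: dom_refl.
- by rewrite poly_le_lt // addrC size_polyDl ?size_polyN.
set N := _ - _; set n := (size (p ^+ 2)).-1.
have nE : N`_n = lead_coef p ^+ 2 - lead_coef h * lead_coef q ^+ 2.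
  rewrite coefB.
  have <- : lead_coef (h * q ^+ 2) = (h * q ^+ 2)`_n by rewrite lead_coefE s.
  by rewrite lead_coefM -!lead_coef_exp.
have od : odd (size h).
  have e : (size h + size q + size q).-2 = (size p + size p).-1.
    by rewrite -sp -sh.
  by move: e pg qg hg; move: (size h) (size p) (size q) => a b c; lia.
have t0 := hP od (lead_coef p) (lead_coef q); rewrite -nE in t0.
have N0 : N`_n != 0.
  apply: contraTneq t0 => ->; apply: (dom_le0 leP).
  by rewrite expf_neq0 // lead_coef_eq0.
have sN : size N = size (p ^+ 2).
  apply/eqP; rewrite eqn_leq; apply/andP; split.
    by rewrite (leq_trans (size_polyD _ _)) // size_polyN s maxnn.
  move: N0; apply: contraR; rewrite -ltnNge => lt.
  by rewrite nth_default // -ltnS prednK // sp; lia.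
by rewrite (poly_le_eq _ (esym sN)) lead_coef_exp [lead_coef N]lead_coefE sN.
Qed.

(** * Norms and lower bounds for the dimension *)

(** [D] is [A[z] / (z ^+ 2 - h)], free over [A] with basis [1, z]. *)
Record quad_ext (A D : idomainType) (iota : {rmorphism A -> D}) (z : D) (h : A) :
    Prop := QuadExt {
  qe_sqr : z ^+ 2 = iota h;
  qe_gen : forall d, exists p q, d = iota p + iota q * z;
  qe_free : forall p q, iota p + iota q * z = 0 -> p = 0 /\ q = 0 }.

Lemma quad_mul (A D : comNzRingType) (iota : {rmorphism A -> D}) z h :
    z ^+ 2 = iota h -> forall p q p' q',
  (iota p + iota q * z) * (iota p' + iota q' * z) =
  iota (p * p' + h * (q * q')) + iota (p * q' + q * p') * z.
Proof.
by rewrite expr2 => zz p q p' q'; rewrite !rmorphD !rmorphM /= -zz; ring.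
Qed.

Section QuadraticExtension.
Variables (A D : idomainType) (iota : {rmorphism A -> D}) (z : D) (h : A).
Hypothesis H : quad_ext iota z h.
Local Notation R := (recip_complement D).

Let qe_mul := quad_mul (qe_sqr H).

(** Otherwise [p + q z] would be a zero divisor of [D]. *)
Lemma qe_norm0 p q : p ^+ 2 = h * q ^+ 2 -> p = 0.
Proof.
move=> e; have /eqP : (iota p + iota q * z) * (iota p + iota (- q) * z) = 0.
  rewrite qe_mul mulrN mulrN -!expr2 e subrr mulrN [p * q]mulrC addNr.
  by rewrite rmorph0 mul0r addr0.
by rewrite mulf_eq0 => /orP[] /eqP /(qe_free H) [].
Qed.

Lemma qe_inj p q p' q' : iota p + iota q * z = iota p' + iota q' * z ->
  p = p' /\ q = q'.
Proof.
move=> e; have [|/eqP + /eqP] := @qe_free _ _ _ _ _ H (p - p') (q - q').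
  by rewrite !rmorphB mulrBl addrACA -opprD e subrr.
by rewrite !subr_eq0 => /eqP -> /eqP ->.
Qed.

Definition qe_re d : A := sval (cid (qe_gen H d)).
Definition qe_im d : A := sval (cid (svalP (cid (qe_gen H d)))).
Definition qe_norm d := qe_re d ^+ 2 - h * qe_im d ^+ 2.

Lemma qeE d : d = iota (qe_re d) + iota (qe_im d) * z.
Proof. exact: svalP (cid (svalP (cid (qe_gen H d)))). Qed.

Lemma qe_normE p q : qe_norm (iota p + iota q * z) = p ^+ 2 - h * q ^+ 2.
Proof.
by rewrite /qe_norm; have [<- <-] := qe_inj (qeE (iota p + iota q * z)).
Qed.

Lemma qe_norm_iota p : qe_norm (iota p) = p ^+ 2.
Proof.
have := qe_normE p 0; rewrite rmorph0 mul0r addr0 => ->.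
by rewrite expr0n mulr0 subr0.
Qed.

Lemma qe_normM a b : qe_norm (a * b) = qe_norm a * qe_norm b.
Proof. by rewrite {1}[a]qeE {1}[b]qeE qe_mul qe_normE /qe_norm; ring. Qed.

Lemma qe_norm_eq0 a : (qe_norm a == 0) = (a == 0).
Proof.
apply/idP/eqP => [|->]; last first.
  by rewrite -(rmorph0 iota) qe_norm_iota expr0n.
rewrite subr_eq0 => /eqP e; have re0 := qe_norm0 e.
move/eqP: e; rewrite re0 expr0n /= eq_sym mulf_eq0 => /orP[/eqP h0|].
  have /eqP : z ^+ 2 = 0 by rewrite (qe_sqr H) h0 rmorph0.
  rewrite expf_eq0 => /andP[_ /eqP z0].
  have [_] : 0 = 0 :> A /\ 1 = 0 :> A.
    by apply: (qe_free H); rewrite z0 mulr0 rmorph0 addr0.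
  by move/eqP; rewrite oner_eq0.
rewrite expf_eq0 => /andP[_ /eqP im0].
by rewrite [a]qeE re0 im0 !rmorph0 mul0r addr0.
Qed.

(** Only the compatibility with differences is not inherited at once.  Absence
of cancellation says that bounding the norm of [p + q z] amounts to bounding
[p ^+ 2] and [h * q ^+ 2] separately, and these bounds pass to differences of
the coordinates. *)
Lemma norm_dominance le : dominance le -> norm_dom le h ->
  dominance (fun a b => le (qe_norm a) (qe_norm b)).
Proof.
move=> leP NC; split=> [a b|b a c|c a b c0|a b c ac bc||a a0].
- exact: (dom_total leP).
- exact: (dom_trans leP).
- by rewrite !qe_normM (dom_mul leP) // qe_norm_eq0.
- have bound p q e : le (p ^+ 2 - h * q ^+ 2) e ->
      le (p ^+ 2) e /\ le (h * q ^+ 2) e.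
    move=> ne; have pe := dom_trans leP (NC p q) ne; split=> //.
    have -> : h * q ^+ 2 = p ^+ 2 - (p ^+ 2 - h * q ^+ 2) by ring.
    exact: (dom_sub leP).
  have subsq p q : le ((p - q) ^+ 2) (p ^+ 2) \/ le ((p - q) ^+ 2) (q ^+ 2).
    rewrite !expr2; case/orP: (dom_total leP p q) => pq; [right|left];
      by apply: (dom_mul2 leP); apply: (dom_sub leP) => //; apply: (dom_refl leP).
  have [pa qa] := bound _ _ _ ac; have [pb qb] := bound _ _ _ bc.
  rewrite {1}[a]qeE {1}[b]qeE opprD addrACA -mulrBl -!rmorphB qe_normE.
  apply: (dom_sub leP).
    by case: (subsq (qe_re a) (qe_re b)) => /(dom_trans leP); apply.
  case: (subsq (qe_im a) (qe_im b)) => s.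
    by apply: (dom_trans leP) qa; apply: (dom_mul2 leP) => //; apply: (dom_refl leP).
  by apply: (dom_trans leP) qb; apply: (dom_mul2 leP) => //; apply: (dom_refl leP).
- rewrite -(rmorph1 iota) -(rmorph0 iota) !qe_norm_iota expr1n expr0n.
  exact: dom_10.
- by rewrite -(rmorph1 iota) qe_norm_iota expr1n (dom_1 leP) // qe_norm_eq0.
Qed.

(** Absence of cancellation for the finest dominance implies it for the coarser
ones. *)
Lemma norm_chain (d : nat) (le : 'I_d.+1 -> rel A) :
    (forall i, dominance (le i)) ->
    (forall i j : 'I_d.+1, (i < j)%N -> subrel (le j) (le i)) ->
    (forall i j : 'I_d.+1, (i < j)%N -> exists x, le i x 1 /\ ~~ le j x 1) ->
    norm_dom (le ord_max) h ->
  prime_chain R d.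
Proof.
move=> leP sub strict NC.
have NCi i : norm_dom (le i) h.
  move=> p q; have := NC p q; have := leq_ord i; rewrite leq_eqVlt.
  case/orP => [/eqP e|lt]; last by apply: sub.
  by have -> : i = ord_max by apply: val_inj.
pose le' i := fun a b : D => le i (qe_norm a) (qe_norm b).
apply: (@prime_chain_dom _ d le') => [i|i j ij a b|i j ij].
- exact: norm_dominance.
- exact: sub.
have [x [xi xj]] := strict i j ij; exists (iota x).
rewrite /le' -(rmorph1 iota) !qe_norm_iota !expr2 mulr1; split.
- apply: contraNneq xj => /eqP; rewrite -qe_norm_eq0 qe_norm_iota sqrf_eq0.
  by move/eqP ->; rewrite (dom_0 (leP j)).
- by rewrite -(mulr1 1); apply: (dom_mul2 (leP i)).
- apply: contra xj => xx; have /orP[//|x1] := dom_total (leP j) x 1.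
  apply: (dom_trans (leP j)) xx; rewrite -[X in le j X]mulr1.
  by apply: (dom_mul2 (leP j)) => //; apply: (dom_refl (leP j)).
Qed.

End QuadraticExtension.

Lemma prime_chain1 (B D : idomainType) (iota : {rmorphism {poly B} -> D}) z h :
    quad_ext iota z h -> norm_dom (poly_le (@triv_le B)) h ->
  prime_chain (recip_complement D) 1.
Proof.
move=> H NC; have BP := poly_dominance (@triv_dominance B).
pose le (i : 'I_2) : rel {poly B} := if i == 0 :> nat then @triv_le _ else poly_le (@triv_le B).
apply: (@norm_chain _ _ _ _ _ H 1 le) => //.
- by case=> [[|[|//]] ?] //=; apply: triv_dominance.
- case=> [[|[|//]] ?] //= [[|[|//]] ?] //= _ a b; rewrite /le /=.
  rewrite /triv_le; have [->|] := eqVneq b 0; last by rewrite orbT.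
  by move/(dom_0P BP) ->; rewrite eqxx.
- case=> [[|[|//]] ?] //= [[|[|//]] ?] //= _; exists 'X.
  by rewrite /le /= /triv_le oner_eq0 orbT poly_le_gt // size_poly1 size_polyX.
Qed.

Lemma prime_chain2 (B D : idomainType) (iota : {rmorphism {poly {poly B}} -> D}) z h :
    quad_ext iota z h -> norm_dom (poly_le (poly_le (@triv_le B))) h ->
  prime_chain (recip_complement D) 2.
Proof.
move=> H NC; have BP := poly_dominance (@triv_dominance B).
have BBP := poly_dominance BP.
pose le (i : 'I_3) : rel {poly {poly B}} :=
  nth (@triv_le _) [:: @triv_le _; poly_le (@triv_le {poly B}); poly_le (poly_le (@triv_le B))] i.
have sub1 : subrel (poly_le (poly_le (@triv_le B))) (poly_le (@triv_le {poly B})).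
  move=> a b; rewrite /poly_le /triv_le => /andP[-> /=].
  have [->|_] := eqVneq (lead_coef b) 0; last by rewrite orbT.
  by move/(dom_0P BP) ->; rewrite eqxx.
have sub0 : subrel (poly_le (@triv_le {poly B})) (@triv_le {poly {poly B}}).
  move=> a b; rewrite [triv_le _ _]/triv_le.
  have [->|] := eqVneq b 0; last by rewrite orbT.
  by move/(dom_0P (poly_dominance (@triv_dominance _))) ->; rewrite eqxx.
apply: (@norm_chain _ _ _ _ _ H 2 le) => //.
- case=> [[|[|[|//]]] ?] //=; first exact: triv_dominance.
  exact: poly_dominance (@triv_dominance _).
- case=> [[|[|[|//]]] ?] //= [[|[|[|//]]] ?] //= _ a b; rewrite /le /=.
  by move=> ab; apply/sub0/sub1.
- case=> [[|[|[|//]]] ?] //= [[|[|[|//]]] ?] //= _; rewrite /le /=.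
  + exists 'X; rewrite /triv_le oner_eq0 orbT poly_le_gt //.
    by rewrite size_poly1 size_polyX.
  + exists 'X; rewrite /triv_le oner_eq0 orbT poly_le_gt //.
    by rewrite size_poly1 size_polyX.
  + have s1 : size ('X%:P : {poly {poly B}}) = size (1 : {poly {poly B}}).
      by rewrite size_polyC polyX_eq0 size_poly1.
    exists 'X%:P; rewrite !(poly_le_eq _ s1).
    rewrite lead_coefC lead_coef1 poly_le_gt ?size_poly1 ?size_polyX //.
    by rewrite /triv_le oner_eq0 orbT.
Qed.

(** * Algebraic dependence by counting monomials *)

(** Evaluation at [x] of a polynomial whose coefficients are read through [f];
iterated, it evaluates polynomials in several variables. *)
Definition ev (B S : comNzRingType) (f : {rmorphism B -> S}) (x : S) :
  {poly B} -> S := horner_morph (fun b => mulrC x (f b)).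

HB.instance Definition _ (B S : comNzRingType) (f : {rmorphism B -> S}) (x : S) :=
  GRing.RMorphism.on (ev f x).

Section Ev.
Variables (B S : comNzRingType) (f : {rmorphism B -> S}) (x : S).
Lemma evC b : ev f x b%:P = f b.
Proof. exact: horner_morphC. Qed.
Lemma evX : ev f x 'X = x.
Proof. exact: horner_morphX. Qed.
Lemma evMXaddC p c : ev f x (p * 'X + c%:P) = ev f x p * x + f c.
Proof. by rewrite rmorphD rmorphM /= evX evC. Qed.
Lemma ev_poly n (E : nat -> B) :
  ev f x (\poly_(i < n) E i) = \sum_(i < n) f (E i) * x ^+ i.
Proof.
rewrite poly_def rmorph_sum; apply: eq_bigr => i _.
by rewrite -mul_polyC rmorphM rmorphXn /= evC evX.
Qed.
End Ev.

Lemma lin_dep (K : fieldType) (I J : finType) (c : I -> J -> K) :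
  (#|J| < #|I|)%N ->
  exists2 u : I -> K, exists i, u i != 0 & forall j, \sum_i u i * c i j = 0.
Proof.
move=> ltJI; pose C : 'M_(#|I|, #|J|) := \matrix_(i, j) c (enum_val i) (enum_val j).
have : kermx C != 0.
  rewrite kermx_eq0 /row_free neq_ltn.
  by rewrite (leq_ltn_trans (rank_leq_col C) ltJI).
case/rowV0Pn => v /sub_kermxP vC /rV0Pn[i vi].
exists (fun i => v 0 (enum_rank i)); first by exists (enum_val i); rewrite enum_valK.
move=> j; move/rowP/(_ (enum_rank j)): vC; rewrite !mxE => e.
rewrite -[RHS]e (reindex_onto enum_val enum_rank) /=; last by move=> k _; rewrite enum_rankK.
by apply: eq_big => [k|k _]; rewrite ?enum_valK ?eqxx // mxE enum_rankK.
Qed.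

Section Filtration.
Variable K : fieldType.
Local Notation A := {poly {poly K}}.
Implicit Types p q : A.

(** Both degrees of [p] are at most [m]. *)
Definition box m p := (size p <= m.+1)%N /\ forall i, (size (p`_i)%R <= m.+1)%N.

Lemma box_mono m n p : (m <= n)%N -> box m p -> box n p.
Proof. by move=> mn [? h]; split=> [|i]; apply: leq_trans (mn : (m.+1 <= n.+1)%N). Qed.

Lemma boxD m p q : box m p -> box m q -> box m (p + q).
Proof.
move=> [sp hp] [sq hq]; split=> [|i]; rewrite ?coefD;
by rewrite (leq_trans (size_polyD _ _)) // geq_max ?sp ?sq ?hp ?hq.
Qed.

Lemma boxM m n p q : box m p -> box n q -> box (m + n) (p * q).
Proof.
move=> [sp hp] [sq hq]; split=> [|i].
  by rewrite (leq_trans (size_polyMleq _ _)) //; lia.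
rewrite coefM (leq_trans (size_sum _ _ _)) //; apply/bigmax_leqP => j _.
rewrite (leq_trans (size_polyMleq _ _)) //.
by have := hp j; have := hq (i - j)%N; lia.
Qed.

Lemma box1 : box 0 1.
Proof.
by split=> [|i]; rewrite ?size_poly1 // coef1; case: eqP; rewrite ?size_poly1 ?size_poly0.
Qed.

Lemma box0 m : box m 0.
Proof. by split=> [|i]; rewrite ?coef0 size_poly0. Qed.

Lemma box_ex p : exists m, box m p.
Proof.
exists (size p + \sum_(i < size p) size (p`_i)%R)%N; split=> [|i]; first lia.
case: (ltnP i (size p)) => ip; last by rewrite (nth_default _ ip) size_poly0.
by rewrite (bigD1 (Ordinal ip)) //=; lia.
Qed.

Variables (D : idomainType) (iota : {rmorphism A -> D}) (z : D) (h : A).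
Hypothesis H : quad_ext iota z h.

Definition dbox m d := exists p q, [/\ box m p, box m q & d = iota p + iota q * z].

Lemma dbox_mono m n d : (m <= n)%N -> dbox m d -> dbox n d.
Proof.
by move=> mn [p [q [bp bq e]]]; exists p, q; split=> //; apply: (box_mono mn).
Qed.

Lemma dbox_ex d : exists m, dbox m d.
Proof.
have [p [q ->]] := qe_gen H d; have [m bp] := box_ex p; have [n bq] := box_ex q.
exists (m + n)%N, p, q; split=> //; first by apply: box_mono bp; lia.
by apply: box_mono bq; lia.
Qed.

(** Multiplying coordinates creates the extra factor [h], of bidegree at most
[r]. *)
Lemma dboxM r m n a b : box r h -> dbox m a -> dbox n b -> dbox (m + (n + r)) (a * b).
Proof.
move=> bh [p [q [bp bq ->]]] [p' [q' [bp' bq' ->]]].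
exists (p * p' + h * (q * q')), (p * q' + q * p'); split; last exact: (quad_mul (qe_sqr H)).
  apply: boxD; first by apply: (@box_mono (m + n)); [lia|apply: boxM].
  by apply: (@box_mono (r + (m + n))); [lia|apply/boxM/boxM].
by apply: (@box_mono (m + n)); [lia|apply: boxD; apply: boxM].
Qed.

Lemma dboxX r m d a b i : box r h -> dbox m a -> dbox d b -> dbox (m + i * (d + r)) (a * b ^+ i).
Proof.
move=> bh ba bb; elim: i => [|i IH]; first by rewrite mul0n addn0 expr0 mulr1.
by rewrite exprSr mulrA mulSnr addnA; apply: dboxM.
Qed.

(** An element of [dbox M] has [2 * M.+1 ^ 2] scalar coordinates. *)
Lemma dbox_dep (I : finType) (v : I -> D) M :
    (forall i, dbox M (v i)) -> (2 * M.+1 ^ 2 < #|I|)%N ->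
  exists2 u : I -> K, exists i, u i != 0 & \sum_i iota (u i)%:P%:P * v i = 0.
Proof.
move=> bv lt.
have [p /choice[q pq]] := choice bv.
pose c (i : I) (t : bool * ('I_M.+1 * 'I_M.+1)) : K :=
  (if t.1 then q i else p i)`_t.2.1`_t.2.2.
have [|u u0 uc] := @lin_dep K I _ c; first by rewrite !card_prod card_bool !card_ord mulnn.
exists u => //.
have zero (b : bool) : \sum_i (u i)%:P%:P * (if b then q i else p i) = 0.
  apply/polyP => s; apply/polyP => t; rewrite !coef0 coef_sum.
  case: (ltnP s M.+1) => sM; last first.
    rewrite big1 ?coef0 // => i _; have [[sp _] [sq _] _] := pq i.
    by rewrite coefCM nth_default ?mulr0 //; case: b; apply: leq_trans sM.
  case: (ltnP t M.+1) => tM; last first.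
    rewrite coef_sum big1 // => i _; have [[_ sp] [_ sq] _] := pq i.
    by rewrite !coefCM nth_default ?mulr0 //; case: b; apply: leq_trans tM.
  rewrite -[RHS](uc (b, (Ordinal sM, Ordinal tM))) coef_sum; apply: eq_bigr => i _.
  by rewrite !coefCM.
transitivity (iota (\sum_i (u i)%:P%:P * p i) + iota (\sum_i (u i)%:P%:P * q i) * z).
  rewrite !rmorph_sum mulr_suml -big_split; apply: eq_bigr => i _ /=.
  by have [_ _ ->] := pq i; rewrite !rmorphM mulrDr mulrA.
by rewrite (zero false) (zero true) !rmorph0 mul0r addr0.
Qed.

(** The products of [3 * n] factors among [a1, a2, a3, b] lie in a box of size
linear in [n], hence in a space of dimension quadratic in [n], while there are
[n ^ 3] monomials. *)
Lemma monomials_dep (a1 a2 a3 b : D) : exists n (u : 'I_n * 'I_n * 'I_n -> K),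
  (exists t, u t != 0) /\
  \sum_t iota (u t)%:P%:P *
    (a1 ^+ t.1.1 * a2 ^+ t.1.2 * a3 ^+ t.2 * b ^+ (3 * n - t.1.1 - t.1.2 - t.2)) = 0.
Proof.
have [r bh] := box_ex h.
have [m1 b1] := dbox_ex a1; have [m2 b2] := dbox_ex a2.
have [m3 b3] := dbox_ex a3; have [m4 b4] := dbox_ex b.
pose d := (m1 + m2 + m3 + m4)%N; pose e := (d + r)%N.
have [{}b1 {}b2 {}b3 {}b4] : [/\ dbox d a1, dbox d a2, dbox d a3 & dbox d b].
  by split; [apply: dbox_mono b1|apply: dbox_mono b2|apply: dbox_mono b3
    |apply: dbox_mono b4]; rewrite /d; lia.
(* So that [2 * (3 * n * e).+1 ^ 2 <= n ^ 2 * n.-1 < n ^ 3]. *)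
pose n := (2 * (3 * e).+1 ^ 2).+1; exists n.
have [|| u u0 e0] := @dbox_dep ('I_n * 'I_n * 'I_n)%type (fun t : 'I_n * 'I_n * 'I_n =>
  a1 ^+ t.1.1 * a2 ^+ t.1.2 * a3 ^+ t.2 * b ^+ (3 * n - t.1.1 - t.1.2 - t.2))
  (3 * n * e)%N; last by exists u.
- move=> [[i j] k] /=; have := ltn_ord i; have := ltn_ord j; have := ltn_ord k.
  move=> kn jn lin.
  have d1 : dbox 0 1.
    exists 1, 0; split; [exact: box1|exact: box0|].
    by rewrite rmorph1 rmorph0 mul0r addr0.
  have := dboxX (3 * n - i - j - k) bh (dboxX k bh (dboxX j bh (dboxX i bh d1 b1) b2) b3) b4.
  rewrite mul1r add0n -/e -!mulnDl; congr dbox; congr (_ * _)%N; lia.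
- rewrite !card_prod !card_ord.
  have : (2 * (3 * n * e).+1 ^ 2 <= n ^ 2 * (2 * (3 * e).+1 ^ 2))%N.
    rewrite mulnCA leq_pmul2l // -expnMn leq_exp2r //.
    by rewrite mulnS mulnCA mulnA; lia.
  move/leq_ltn_trans; apply; rewrite -mulnn ltn_pmul2l ?muln_gt0 //.
Qed.

End Filtration.

(** * Upper bounds for the dimension *)

(** Write [F] as a power of the variable times a polynomial with nonzero
constant term [b].  The power can be cancelled modulo [P] because [x] is not in
[P], and then [b] is minus a multiple of [x], modulo [P]. *)
Lemma lowest_coef (B R : comNzRingType) (f : {rmorphism B -> R})
    (P P' : prime_idealr R) (x : R) (F : {poly B}) :
  {subset P <= P'} -> x \notin P -> x \in P' -> F != 0 -> ev f x F \in P ->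
  exists2 b, b != 0 & f b \in P'.
Proof.
move=> sub xP xP'; elim/poly_ind: F => [|F c IH]; first by rewrite eqxx.
rewrite rmorphD rmorphM /= evC evX => F0 FP.
have [c0|c0] := eqVneq c 0; last first.
  exists c => //; have -> : f c = (ev f x F * x + f c) - ev f x F * x by rewrite addrC addKr.
  by rewrite rpredB //; [apply: sub|apply: idealMr].
move: FP; rewrite c0 rmorph0 addr0 prime_idealrM (negPf xP) orbF; apply: IH.
by apply: contraNneq F0 => ->; rewrite c0 mul0r addr0.
Qed.

Lemma ev_poly3 (B R : comNzRingType) (f : {rmorphism B -> R}) (y1 y2 y3 : R) n
    (v : nat -> nat -> nat -> B) :
  ev (ev (ev f y1) y2) y3
    (\poly_(i < n) \poly_(j < n) \poly_(k < n) v i j k) =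
  \sum_(t : 'I_n * 'I_n * 'I_n)
    f (v t.1.1 t.1.2 t.2) * (y3 ^+ t.1.1 * y2 ^+ t.1.2 * y1 ^+ t.2).
Proof.
rewrite ev_poly -(pair_bigA _ (fun (p : 'I_n * 'I_n) (k : 'I_n) => f (v p.1 p.2 k) *
  (y3 ^+ p.1 * y2 ^+ p.2 * y1 ^+ k))) /=.
rewrite -(pair_bigA _ (fun i j : 'I_n => \sum_(k < n) f (v i j k) *
  (y3 ^+ i * y2 ^+ j * y1 ^+ k))) /=.
apply: eq_bigr => i _; rewrite /= ev_poly mulr_suml.
apply: eq_bigr => j _; rewrite /= ev_poly !mulr_suml; apply: eq_bigr => k _; ring.
Qed.

Definition inverts (B R : comNzRingType) (f : {rmorphism B -> R}) :=
  forall b, b != 0 -> exists c, f b * c = 1.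

Lemma inverts_notin (B R : comNzRingType) (f : {rmorphism B -> R}) (P : prime_idealr R) b :
  inverts f -> b != 0 -> f b \notin P.
Proof.
move=> fU b0; have [c e] := fU b b0; apply/negP => fP.
have : 1 \in P by rewrite -e mulrC idealMr.
by rewrite idealr1.
Qed.

Lemma chain_gap (R : comNzRingType) d (P : 'I_d.+1 -> prime_idealr R) (i j : 'I_d.+1) :
  (forall i j : 'I_d.+1, (i < j)%N ->
      {subset P i <= P j} /\ ~ {subset P j <= P i}) -> (i < j)%N ->
  exists x, [/\ {subset P i <= P j}, x \notin P i & x \in P j].
Proof.
move=> ch ij; have [sub nsub] := ch i j ij.
case: (pselect (exists x, x \notin P i /\ x \in P j)) => [[x [? ?]]|nex].
  by exists x.
case: nsub => x xj; case: (boolP (x \in P i)) => // xi.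
by case: nex; exists x.
Qed.

Section ChainBounds.
Variables (B R : comNzRingType) (f : {rmorphism B -> R}).
Hypothesis fU : inverts f.

(** Lowest coefficients, taken in both variables, put the image of a nonzero
element of [B] in the third prime of a chain, although that image is
invertible. *)
Lemma chain_bound1 e :
    (forall y1 y2, exists2 G, G != 0 & ev (ev f y1) y2 G = 0) ->
  prime_chain R e -> (e <= 1)%N.
Proof.
move=> dep [P ch]; rewrite leqNgt; apply/negP => e2.
have lt i j : (i < j)%N -> (j < e.+1)%N -> ((inord i : 'I_e.+1) < (inord j : 'I_e.+1))%N.
  by move=> ij je; rewrite !inordK // (ltn_trans ij).
have [x1 [s1 n1 m1]] := chain_gap ch (lt 0%N 1%N isT (ltnW e2)).
have [x2 [s2 n2 m2]] := chain_gap ch (lt 1%N 2%N isT e2).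
have [G G0 GE] := dep x2 x1.
have [|G' G'0 G'P] := lowest_coef (f := ev f x2) s1 n1 m1 G0; first by rewrite GE rpred0.
have [b b0 bP] := lowest_coef s2 n2 m2 G'0 G'P.
by have := inverts_notin (P (inord 2%N)) fU b0; rewrite bP.
Qed.

Lemma chain_bound2 e :
    (forall y1 y2 y3, exists2 G, G != 0 & ev (ev (ev f y1) y2) y3 G = 0) ->
  prime_chain R e -> (e <= 2)%N.
Proof.
move=> dep [P ch]; rewrite leqNgt; apply/negP => e3.
have lt i j : (i < j)%N -> (j < e.+1)%N -> ((inord i : 'I_e.+1) < (inord j : 'I_e.+1))%N.
  by move=> ij je; rewrite !inordK // (ltn_trans ij).
have [x1 [s1 n1 m1]] := chain_gap ch (lt 0%N 1%N isT (ltnW (ltnW e3))).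
have [x2 [s2 n2 m2]] := chain_gap ch (lt 1%N 2%N isT (ltnW e3)).
have [x3 [s3 n3 m3]] := chain_gap ch (lt 2%N 3%N isT e3).
have [G G0 GE] := dep x3 x2 x1.
have [|G' G'0 G'P] := lowest_coef (f := ev (ev f x3) x2) s1 n1 m1 G0; first by rewrite GE rpred0.
have [G'' G''0 G''P] := lowest_coef (f := ev f x3) s2 n2 m2 G'0 G'P.
have [b b0 bP] := lowest_coef s3 n3 m3 G''0 G''P.
by have := inverts_notin (P (inord 3%N)) fU b0; rewrite bP.
Qed.
End ChainBounds.

Section Scalars.
Variables (K : fieldType) (D : idomainType) (k : {rmorphism K -> D}).
Local Notation R := (recip_complement D).
Local Notation "x %:F" := (FracField.tofrac x).

Lemma scalar_recip c : (k c)%:F \in @recip_pred D.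
Proof.
have [->|c0] := eqVneq c 0; first by rewrite rmorph0 tofrac0 rpred0.
have kV : k c^-1 != 0 by rewrite fmorph_eq0 invr_eq0.
suff -> : (k c)%:F = (k c^-1)%:F^-1 by apply: recip_inv_mem.
apply: (mulIf (x := (k c^-1)%:F)); first by rewrite tofrac_eq0.
by rewrite mulVf ?tofrac_eq0 // -tofracM -rmorphM divff // rmorph1 tofrac1.
Qed.

(** A nonzero scalar is the reciprocal of its inverse. *)
Definition recip_scalar (c : K) : R := Sub (k c)%:F (scalar_recip c).

Lemma scalar_zmod : zmod_morphism recip_scalar.
Proof. by move=> a b; apply: val_inj; rewrite /= rmorphB tofracB. Qed.

Lemma scalar_monoid : monoid_morphism recip_scalar.
Proof.
by split=> [|a b]; apply: val_inj; rewrite /= ?rmorph1 ?rmorphM ?tofracM.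
Qed.

HB.instance Definition _ := GRing.isZmodMorphism.Build K R recip_scalar scalar_zmod.
HB.instance Definition _ := GRing.isMonoidMorphism.Build K R recip_scalar scalar_monoid.

Lemma recip_scalar_inverts : inverts recip_scalar.
Proof.
by move=> c c0; exists (recip_scalar c^-1); rewrite -rmorphM divff // rmorph1.
Qed.
End Scalars.

Lemma clear_denoms (F : fieldType) (u c1 c2 c3 b : F) i j k m :
    b != 0 -> (i + j + k <= m)%N ->
  u * ((c1 / b) ^+ i * (c2 / b) ^+ j * (c3 / b) ^+ k) * b ^+ m =
  u * (c1 ^+ i * c2 ^+ j * c3 ^+ k * b ^+ (m - i - j - k)).
Proof.
move=> b0 le; rewrite !expr_div_n.
have -> : b ^+ m = b ^+ i * b ^+ j * b ^+ k * b ^+ (m - i - j - k).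
  by rewrite -!exprD; congr (_ ^+ _); lia.
by field; rewrite !expf_neq0.
Qed.

Section Dependence.
Variable K : fieldType.
Local Notation A := {poly {poly K}}.
Variables (D : idomainType) (iota : {rmorphism A -> D}) (z : D) (h : A).
Hypothesis H : quad_ext iota z h.
Local Notation R := (recip_complement D).
Local Notation "x %:F" := (FracField.tofrac x).

Definition qe_scalar : K -> D := iota \o polyC \o polyC.
HB.instance Definition _ := GRing.RMorphism.on qe_scalar.

(** Over a common denominator, this is the dependence of monomials of
[monomials_dep] divided by a power of the denominator. *)
Lemma recip_dep (y1 y2 y3 : R) : exists2 G : {poly {poly {poly K}}},
  G != 0 & ev (ev (ev (recip_scalar qe_scalar) y1) y2) y3 G = 0.
Proof.
have tP := triv_dominance D.
have [a1 [b1 [n1 e1 _]]] := recip_dom tP (valP y1).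
have [a2 [b2 [n2 e2 _]]] := recip_dom tP (valP y2).
have [a3 [b3 [n3 e3 _]]] := recip_dom tP (valP y3).
pose b := b1 * b2 * b3.
have b0 : b != 0 by rewrite !mulf_neq0.
have common a d c : d != 0 -> c * d = a * b -> a%:F / d%:F = c%:F / b%:F.
  move=> d0 e; apply/eqP; rewrite eqr_div ?tofrac_eq0 // -!tofracM tofrac_eq.
  by rewrite e.
have {}e1 : val y1 = (a1 * b2 * b3)%:F / b%:F.
  by rewrite e1; apply: common => //; rewrite /b; ring.
have {}e2 : val y2 = (b1 * a2 * b3)%:F / b%:F.
  by rewrite e2; apply: common => //; rewrite /b; ring.
have {}e3 : val y3 = (b1 * b2 * a3)%:F / b%:F.
  by rewrite e3; apply: common => //; rewrite /b; ring.
clear common; move: b b0 e1 e2 e3 => b b0.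
move: (a1 * b2 * b3) (b1 * a2 * b3) (b1 * b2 * a3).
move=> c1 c2 c3 e1 e2 e3.
have [[|n] [u [[t ut] ue]]] := monomials_dep H c3 c2 c1 b; first by case: t {ut} => -[[]].
pose v i j k := u (inord i, inord j, inord k).
exists (\poly_(i < n.+1) \poly_(j < n.+1) \poly_(k < n.+1) v i j k).
  apply: contraNneq ut => /polyP/(_ t.1.1)/polyP/(_ t.1.2)/polyP/(_ t.2).
  rewrite !coef0 !(coef_poly, ltn_ord) /v !inord_val.
  by case: t => -[i j] k /= ->.
have vE c i j k : val (recip_scalar qe_scalar c * (y3 ^+ i * y2 ^+ j * y1 ^+ k)) =
    (iota c%:P%:P)%:F *
      ((c3%:F / b%:F) ^+ i * (c2%:F / b%:F) ^+ j * (c1%:F / b%:F) ^+ k).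
  by rewrite -e1 -e2 -e3 !rmorphM !rmorphXn.
apply: val_inj; rewrite rmorph0 ev_poly3 rmorph_sum.
have bF : b%:F != 0 by rewrite tofrac_eq0.
have bF3 : b%:F ^+ (3 * n.+1) != 0 by rewrite expf_neq0.
apply: (mulIf bF3); rewrite mul0r -[RHS](tofrac0 D) -ue rmorph_sum mulr_suml.
apply: eq_bigr => -[[i j] k] _.
have := vE (u (i, j, k)) i j k; rewrite /v !inord_val => vijk.
have rE : (iota (u (i, j, k))%:P%:P * (c3 ^+ i * c2 ^+ j * c1 ^+ k *
      b ^+ (3 * n.+1 - i - j - k)))%:F =
    (iota (u (i, j, k))%:P%:P)%:F * (c3%:F ^+ i * c2%:F ^+ j * c1%:F ^+ k *
      b%:F ^+ (3 * n.+1 - i - j - k)) by rewrite !tofracM !tofracXn.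
apply: etrans (esym rE); apply: (etrans (congr1 (fun t => t * _) vijk)).
apply: clear_denoms => //.
by have := ltn_ord i; have := ltn_ord j; have := ltn_ord k; lia.
Qed.
End Dependence.

(** * Dimensions from an equation solved for a square *)

Section QuadricDimension.
Variable K : fieldType.
Local Notation A := {poly {poly K}}.
Variables (D : idomainType) (iota : {rmorphism A -> D}) (z : D) (h : A).
Hypothesis H : quad_ext iota z h.
Local Notation R := (recip_complement D).
Local Notation "x %:F" := (FracField.tofrac x).
Local Notation k := (qe_scalar iota).

Lemma krull_dim2 : norm_dom (poly_le (poly_le (@triv_le K))) h -> krull_dim_is R 2.
Proof.
move=> NC; split; first exact: prime_chain2 H NC.
by move=> e; apply: (chain_bound2 (recip_scalar_inverts k) (recip_dep H)).
Qed.

Lemma iota_ev p : iota p%:P = ev k (iota 'X%:P) p.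
Proof.
elim/poly_ind: p => [|p c IH]; first by rewrite !rmorph0.
by rewrite polyCD polyCM rmorphD rmorphM /= IH evMXaddC.
Qed.

Lemma tofrac_ev u p : (ev k u p)%:F = (map_poly (@FracField.tofrac D \o k) p).[u%:F].
Proof.
elim/poly_ind: p => [|p c IH]; first by rewrite !rmorph0 ?tofrac0 horner0.
rewrite evMXaddC tofracD tofracM IH rmorphD rmorphM /=.
by rewrite map_polyX map_polyC !hornerE.
Qed.

Lemma val_ev (u : D) (y : R) (p : {poly K}) : val y = u%:F ->
  val (ev (recip_scalar k) y p) = (ev k u p)%:F.
Proof.
move=> e; elim/poly_ind: p => [|p c IH]; first by rewrite !rmorph0 ?tofrac0.
by rewrite !evMXaddC tofracD tofracM -IH -e rmorphD rmorphM.
Qed.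

Lemma iota_polyC_transc p : ev k (iota 'X%:P) p = 0 -> p = 0.
Proof.
rewrite -iota_ev => e; apply/eqP; rewrite -polyC_eq0.
have [|-> //] := @qe_free _ _ _ _ _ H p%:P 0.
by rewrite e rmorph0 mul0r addr0.
Qed.

Variable c : {poly K}.
Hypotheses (cX : c + c = 'X) (hc : h = (c ^+ 2 + 1)%:P).
Let u := z - iota c%:P.
Let v := z + iota c%:P.

Lemma hyp_uv : v * u = 1.
Proof.
have -> : v * u = z ^+ 2 - iota c%:P ^+ 2 by rewrite /u /v; ring.
by rewrite (qe_sqr H) hc polyCD polyCM rmorphD rmorphM polyC1 rmorph1 addrAC subrr add0r.
Qed.

(** If [u] were algebraic over [K], so would be its inverse [v], and hence
[v - u], which is the variable [X]. *)
Lemma hyp_transc p : ev k u p = 0 -> p = 0.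
Proof.
move=> up; apply: contrapT => /eqP p0.
have uA : algebraicOver (@FracField.tofrac D \o k) u%:F.
  by exists p => //; rewrite /root -tofrac_ev up tofrac0.
have vA : algebraicOver (@FracField.tofrac D \o k) v%:F.
  have -> : v%:F = u%:F^-1; last exact: algebraic_inv.
  have u0 : u%:F != 0.
    by rewrite tofrac_eq0; apply: contraTneq (oner_neq0 D) => u0; rewrite -hyp_uv u0 mulr0 eqxx.
  by apply: (mulIf u0); rewrite mulVf // -tofracM hyp_uv tofrac1.
have := algebraic_sub vA uA.
have -> : v%:F - u%:F = (iota 'X%:P)%:F.
  have -> : 'X%:P = c%:P + c%:P :> A by rewrite -polyCD cX.
  have e : v - u = iota (c%:P + c%:P) by rewrite rmorphD /v /u; ring.
  by rewrite -e tofracB.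
case=> q q0; rewrite /root -tofrac_ev tofrac_eq0 => /eqP /iota_polyC_transc qz.
by rewrite qz eqxx in q0.
Qed.

(** The outer variable does not occur in the equation, and the degree in it
gives a chain of two primes.  For the upper bound, [u] is the reciprocal of
[v], so that [K[u]] lies in the reciprocal complement, where its nonzero
elements, being nonzero elements of [D], have inverses. *)
Lemma krull_dim1 : krull_dim_is R 1.
Proof.
split.
  apply: (prime_chain1 H); apply: norm_dom_poly => [|_].
    exact: triv_dominance.
  rewrite hc lead_coefC; apply: norm_dom_triv => p q e.
  apply/eqP; rewrite -polyC_eq0; apply/eqP; apply: (qe_norm0 H (q := q%:P)).
  by rewrite hc -!polyC_exp e polyCM.
have v0 : v != 0.
  by apply: contraTneq (oner_neq0 D) => v0; rewrite -hyp_uv v0 mul0r eqxx.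
pose y : R := recip_inv v0.
have yu : val y = u%:F.
  have vF : v%:F != 0 by rewrite tofrac_eq0.
  by apply: (mulfI vF); rewrite divff // -tofracM hyp_uv tofrac1.
move=> e; apply: (@chain_bound1 _ _ (ev (recip_scalar k) y)); last first.
  by move=> y1 y2; apply: (recip_dep H).
move=> b b0; have w0 : ev k u b != 0.
  by apply: contraNneq b0 => /hyp_transc ->.
exists (recip_inv w0); apply: val_inj.
rewrite rmorphM; apply: (etrans (congr1 (fun t => t * _) (val_ev b yu))).
by rewrite rmorph1 /= divff // tofrac_eq0.
Qed.

End QuadricDimension.

(** * Affine changes of coordinates *)

(** Constants and variables generate the polynomial ring. *)
Lemma mpoly_gen_ind n (K : comNzRingType) (P : {mpoly K[n]} -> Prop) :
  (forall c, P c%:MP) -> (forall i, P 'X_i) ->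
  (forall p q, P p -> P q -> P (p + q)) -> (forall p q, P p -> P q -> P (p * q)) ->
  forall p, P p.
Proof.
move=> PC PX PD PM; elim/mpolyind => [|c m p _ _ Pp]; first by rewrite -(mpolyC0 n).
apply: (PD) => //; rewrite -mul_mpolyC; apply: (PM) => //.
rewrite -mmap1_id /mmap1; elim/big_rec: _ => [|i q _ Pq]; first by rewrite -mpolyC1.
apply: (PM) => //; elim: (m i) => [|e IH]; first by rewrite expr0 -mpolyC1.
by rewrite exprS; apply: (PM).
Qed.

Section AffineMaps.
Variables (n : nat) (K : fieldType).
Implicit Types (A B : 'M[K]_n) (b c : 'cV[K]_n) (f g p : {mpoly K[n]}).

Lemma comp_affineX A b i : 'X_i \mPo affine_forms A b =
  \sum_(j < n) A i j *: 'X_j + (b i 0)%:MP.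
Proof. by rewrite comp_mpolyXU -tnth_nth tnth_mktuple. Qed.

Lemma comp_affine A b B c p :
  (p \mPo affine_forms A b) \mPo affine_forms B c =
  p \mPo affine_forms (A *m B) (A *m c + b).
Proof.
elim/mpoly_gen_ind: p => [d|i|p q IHp IHq|p q IHp IHq]; last 2 first.
- by rewrite !rmorphD /= IHp IHq.
- by rewrite !rmorphM /= IHp IHq.
- by rewrite !comp_mpolyC.
rewrite !comp_affineX rmorphD rmorph_sum /= comp_mpolyC !mxE mpolyCD addrA.
congr (_ + _).
under eq_bigr => j _ do rewrite comp_mpolyZ comp_affineX scalerDr.
rewrite big_split /=; congr (_ + _); last first.
  by rewrite rmorph_sum /=; apply: eq_bigr => j _; rewrite -mul_mpolyC -mpolyCM.
under eq_bigr => j _ do rewrite scaler_sumr.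
rewrite exchange_big /=; apply: eq_bigr => k _.
by rewrite mxE scaler_suml; apply: eq_bigr => j _; rewrite scalerA.
Qed.

Lemma comp_affine1 p : p \mPo affine_forms 1%:M 0 = p.
Proof.
elim/mpoly_gen_ind: p => [d|i|p q IHp IHq|p q IHp IHq]; last 2 first.
- by rewrite rmorphD /= IHp IHq.
- by rewrite rmorphM /= IHp IHq.
- by rewrite comp_mpolyC.
rewrite comp_affineX mxE mpolyC0 addr0 (bigD1 i) //= big1 => [|j ji].
  by rewrite mxE eqxx scale1r addr0.
by rewrite mxE eq_sym (negPf ji) scale0r.
Qed.

Lemma comp_affineK A b : A \in unitmx ->
  cancel (comp_mpoly (affine_forms A b))
    (comp_mpoly (affine_forms (invmx A) (- (invmx A *m b)))).
Proof.
move=> AU p; rewrite /= comp_affine mulmxN mulmxA mulmxV // mul1mx addNr.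
exact: comp_affine1.
Qed.

Lemma comp_affineVK A b : A \in unitmx ->
  cancel (comp_mpoly (affine_forms (invmx A) (- (invmx A *m b))))
    (comp_mpoly (affine_forms A b)).
Proof.
by move=> AU p; rewrite /= comp_affine mulVmx // subrr comp_affine1.
Qed.

Lemma aff_trans f g p :
  affinely_equivalent f g -> affinely_equivalent g p -> affinely_equivalent f p.
Proof.
move=> [A [b [c [AU c0 e]]]] [A' [b' [c' [AU' c'0 e']]]].
exists (A *m A'), (A *m b' + b), (c * c'); split.
- by rewrite unitmx_mul AU.
- by rewrite mulf_neq0.
- by rewrite -comp_affine e comp_mpolyZ e' scalerA.
Qed.

Lemma aff_refl f : affinely_equivalent f f.
Proof.
by exists 1%:M, 0, 1; rewrite unitmx1 oner_neq0 comp_affine1 scale1r.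
Qed.

Lemma aff_scale f (a : K) : a != 0 -> affinely_equivalent (a *: f) f.
Proof. by move=> a0; exists 1%:M, 0, a; rewrite unitmx1 comp_affine1. Qed.

Lemma aff_irreducible f g p q : irreducible_elt f -> affinely_equivalent f g ->
  g = p * q -> p \is a GRing.unit \/ q \is a GRing.unit.
Proof.
move=> [_ _ fI] [A [b [c [AU c0 e]]]] gpq.
have cU : c%:MP_[n] \is a GRing.unit by rewrite rmorph_unit ?unitfE.
have := congr1 (comp_mpoly (affine_forms (invmx A) (- (invmx A *m b)))) e.
rewrite (comp_affineK _ AU) gpq -mul_mpolyC !rmorphM /= comp_mpolyC mulrA => /fI.
case=> [|qU]; [rewrite unitrM cU /= => pU; left|right].
  by rewrite -[p](comp_affineVK b AU) rmorph_unit.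
by rewrite -[q](comp_affineVK b AU) rmorph_unit.
Qed.

End AffineMaps.

(** * The coordinate ring as a quadratic extension *)

Section PrincQuotient.
Variables (R : idomainType) (p : R) (pp : prime_elt p).

Definition quot_proj : R -> {ideal_quot princ_ideal pp} :=
  \pi_({ideal_quot princ_ideal pp}).
HB.instance Definition _ := GRing.RMorphism.on quot_proj.

Lemma quot_proj0 a : quot_proj a = 0 <-> dvd_elt p a.
Proof.
rewrite -[0](rmorph0 quot_proj); split=> [e|d].
  apply/(princ_idealP pp).
  by rewrite -[a]subr0 Quotient.idealrBE; apply/eqP.
by apply/eqP; rewrite -Quotient.idealrBE subr0; apply/princ_idealP.
Qed.

Lemma quot_proj_surj d : exists a, d = quot_proj a.
Proof. by exists (repr d); rewrite /quot_proj reprK. Qed.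

End PrincQuotient.

Section Presentation.
Variable K : fieldType.
Local Notation A := {poly {poly K}}.
Local Notation X i := ('X_(inord i) : {mpoly K[3]}).

(** The inner variable of [{poly {poly K}}] goes to the first variable of
[{mpoly K[3]}] and the outer one to the second. *)
Definition emb : A -> {mpoly K[3]} := ev (ev (@mpolyC 3 K) (X 0%N)) (X 1%N).
HB.instance Definition _ := GRing.RMorphism.on emb.

Lemma embXX : emb 'X = X 1%N. Proof. exact: evX. Qed.
Lemma embX : emb 'X%:P = X 0%N. Proof. by rewrite [LHS]evC /= evX. Qed.
Lemma embC c : emb c%:P%:P = c%:MP. Proof. by rewrite [LHS]evC /= evC. Qed.

Definition unemb_var (i : 'I_3) : {poly A} :=
  if i == inord 0 then 'X%:P%:P else if i == inord 1 then 'X%:P else 'X.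
(** [{mpoly K[3]}] seen as a polynomial ring in its third variable over
[{poly {poly K}}]. *)
Definition unemb : {mpoly K[3]} -> {poly A} :=
  mmap (polyC \o polyC \o polyC) unemb_var.
HB.instance Definition _ := GRing.RMorphism.on unemb.

Lemma unembX i : unemb 'X_i = unemb_var i.
Proof. by rewrite /unemb mmapX mmap1U. Qed.

Lemma inord_neq i j : (i < 3)%N -> (j < 3)%N -> i != j ->
  (inord i == inord j :> 'I_3) = false.
Proof. by move=> i3 j3; apply: contraNF => /eqP /(congr1 val) /=; rewrite !inordK // => ->. Qed.

Lemma unemb_emb p : unemb (emb p) = p%:P.
Proof.
elim/poly_ind: p => [|p c IH]; first by rewrite !rmorph0.
rewrite rmorphD rmorphM /= embXX !rmorphD !rmorphM /= IH unembX /unemb_var.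
rewrite eqxx inord_neq //; congr (_ + _).
elim/poly_ind: c => [|c a IHc]; first by rewrite !rmorph0.
rewrite !(rmorphD, rmorphM) /= IHc embX embC unembX /unemb_var eqxx.
by rewrite /unemb mmapC.
Qed.

(** The inverse change of coordinates identifies [D] with the quotient of
[{mpoly K[3]}] by [Z ^+ 2 - h].  This polynomial is monic in [Z], of degree
two, so no nonzero [p + q Z] is a multiple of it. *)
Lemma quadric_presentation (f : {mpoly K[3]}) (h : A) (D : idomainType)
    (proj : {rmorphism {mpoly K[3]} -> D}) :
  (forall a, proj a = 0 <-> dvd_elt f a) -> (forall d, exists a, d = proj a) ->
  affinely_equivalent f (X 2%N ^+ 2 - emb h) ->
  exists (iota : {rmorphism A -> D}) z, quad_ext iota z h.
Proof.
move=> proj0 surj [M [b [c [MU c0 fE]]]].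
pose S : {rmorphism {mpoly K[3]} -> {mpoly K[3]}} :=
  comp_mpoly (affine_forms (invmx M) (- (invmx M *m b))).
pose T : {rmorphism {mpoly K[3]} -> {mpoly K[3]}} := comp_mpoly (affine_forms M b).
have TS : cancel S T by apply: comp_affineVK.
have ST : cancel T S by apply: comp_affineK.
have SC k : S k%:MP = k%:MP by apply: comp_mpolyC.
have {}fE : T f = c%:MP * (X 2%N ^+ 2 - emb h) by rewrite mul_mpolyC.
clearbody S T.
have Sg : S (X 2%N ^+ 2 - emb h) = c^-1%:MP * f.
  have := congr1 S fE; rewrite ST rmorphM SC => ->.
  by rewrite mulrA -mpolyCM mulVf // mpolyC1 mul1r.
pose iota : {rmorphism A -> D} := proj \o S \o emb.
have iotaE p : iota p = proj (S (emb p)) by [].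
clearbody iota; pose z := proj (S (X 2%N)).
have zz : z ^+ 2 = iota h.
  apply/eqP; rewrite -subr_eq0; apply/eqP.
  rewrite iotaE /z -!rmorphXn -!rmorphB Sg.
  by apply/proj0; exists (c^-1)%:MP.
exists iota, z; split=> //.
- move=> d; have [a ->] := surj d; rewrite -[a]ST; move: (T a) => {}a.
  elim/mpoly_gen_ind: a => [k|i|p q [p1 [q1 e1]] [p2 [q2 e2]]|p q [p1 [q1 e1]] [p2 [q2 e2]]].
  + exists k%:P%:P, 0; rewrite rmorph0 mul0r addr0.
    by rewrite iotaE embC.
  + case: (i =P inord 0) => [->|i0].
      exists 'X%:P, 0; rewrite rmorph0 mul0r addr0.
      by rewrite iotaE embX.
    case: (i =P inord 1) => [->|i1].
      exists 'X, 0; rewrite rmorph0 mul0r addr0.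
      by rewrite iotaE embXX.
    exists 0, 1; rewrite rmorph0 rmorph1 mul1r add0r.
    suff -> : i = inord 2 by [].
    case: i i0 i1 => [[|[|[|//]]] i3] i0 i1; last by apply: val_inj; rewrite /= inordK.
      by case: i0; apply: val_inj; rewrite /= inordK.
    by case: i1; apply: val_inj; rewrite /= inordK.
  + exists (p1 + p2), (q1 + q2).
    by rewrite [S _]rmorphD [proj _]rmorphD e1 e2 !rmorphD mulrDl addrACA.
  + exists (p1 * p2 + h * (q1 * q2)), (p1 * q2 + q1 * p2).
    by rewrite -(quad_mul zz) -e1 -e2 [S _]rmorphM [proj _]rmorphM.
- move=> p q; have -> : iota p + iota q * z =
      proj (S (emb p + emb q * X 2%N)).
    by rewrite [S _]rmorphD [S (_ * _)]rmorphM [proj _]rmorphD [proj (_ * _)]rmorphM !iotaE.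
  move=> /proj0[r /(congr1 T)]; rewrite TS [T (r * f)]rmorphM fE mulrA.
  move: (_ * c%:MP) => r' /(congr1 unemb).
  rewrite [unemb (_ * _)]rmorphM [unemb (_ + _)]rmorphD /= [unemb (_ - _)]rmorphB.
  rewrite /= [unemb (emb q * _)]rmorphM /= [unemb (_ ^+ _)]rmorphXn /=.
  rewrite !unemb_emb unembX.
  rewrite /unemb_var !inord_neq //; move: (unemb r') => R e2.
  have sz : size ('X ^+ 2 - h%:P : {poly A}) = 3.
    by rewrite size_polyDl size_polyXn // size_polyN (leq_ltn_trans (size_polyC_leq1 _)).
  have R0 : R = 0.
    apply: contrapT => /eqP R0.
    have g0 : 'X ^+ 2 - h%:P != 0 :> {poly A} by rewrite -size_poly_eq0 sz.
    have := congr1 (fun t : {poly A} => size t) e2; rewrite [RHS]size_mul // sz.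
    move=> /eqP; rewrite eqn_leq => /andP[_].
    apply/negP; rewrite -ltnNge (leq_ltn_trans (size_polyD _ _)) // gtn_max.
    have sR : (2 < (size R + 3).-1)%N by rewrite addn3 /= !ltnS size_poly_gt0.
    rewrite (leq_ltn_trans (size_polyC_leq1 _) (ltnW sR)) andTb.
    apply: leq_ltn_trans sR; apply: leq_trans (size_polyMleq _ _) _.
    by rewrite size_polyX addn2 /= ltnS size_polyC_leq1.
  move: e2; rewrite R0 mul0r => /polyP e2; split.
    by have := e2 0%N; rewrite coefD coefMX !coefC /= addr0.
  by have := e2 1%N; rewrite coefD coefMX !coefC /= add0r.
Qed.
End Presentation.

Lemma coord_ring_presentation (K : fieldType) (f : {mpoly K[3]})
    (f_irr : irreducible_elt f) (h : {poly {poly K}}) :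
  affinely_equivalent f ('X_(inord 2) ^+ 2 - emb h) ->
  exists (iota : {rmorphism {poly {poly K}} -> coord_ring f_irr}) z, quad_ext iota z h.
Proof.
apply: (quadric_presentation (proj := quot_proj (mpoly_irr_prime f_irr))).
  exact: quot_proj0.
exact: quot_proj_surj.
Qed.

(** * Affine classification of quadrics *)

(** Substituting for one variable an affine form in which it really occurs. *)
Lemma aff_elem n (K : fieldType) (i : 'I_n) (r : 'I_n -> K) (t : K) : r i != 0 ->
  exists phi : {rmorphism {mpoly K[n]} -> {mpoly K[n]}},
  [/\ forall f, affinely_equivalent f (phi f), forall c, phi c%:MP = c%:MP,
      phi 'X_i = \sum_j r j *: 'X_j + t%:MP & forall j, j != i -> phi 'X_j = 'X_j].
Proof.
move=> ri; pose A : 'M[K]_n := \matrix_(p, q) if p == i then r q else (p == q)%:R.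
pose B : 'M[K]_n := \matrix_(p, q)
  if p == i then (if q == i then (r i)^-1 else - r q / r i) else (p == q)%:R.
pose b : 'cV[K]_n := \col_p if p == i then t else 0.
have AU : A \in unitmx.
  suff /mulmx1_unit[] : A *m B = 1%:M by [].
  apply/matrixP => p q; rewrite !mxE.
  have [->|pi] := eqVneq p i; last first.
    rewrite (bigD1 p) //= big1 => [|k kp]; rewrite !mxE (negPf pi).
      by rewrite eqxx mul1r addr0.
    by rewrite eq_sym (negPf kp) mul0r.
  rewrite (bigD1 i) //= !mxE eqxx; have [->|qi] := eqVneq q i.
    rewrite divff // big1 ?addr0 ?eqxx // => k ki.
    by rewrite !mxE eqxx (negPf ki) mulr0.
  rewrite (bigD1 q) //= big1 => [|k /andP[ki kq]]; last first.
    by rewrite !mxE eqxx (negPf ki) (negPf kq) mulr0.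
  rewrite !mxE eqxx (negPf qi) eqxx mulr1 addr0.
  by rewrite mulrC divfK // addNr.
exists (comp_mpoly (affine_forms A b)); split=> [f|c||j ji].
- by exists A, b, 1; rewrite AU oner_neq0 scale1r.
- exact: comp_mpolyC.
- rewrite /= comp_affineX mxE eqxx; congr (_ + _); apply: eq_bigr => j _.
  by rewrite mxE eqxx.
- rewrite /= comp_affineX mxE (negPf ji) mpolyC0 addr0 (bigD1 j) //= big1 => [|k kj].
    by rewrite mxE (negPf ji) eqxx scale1r addr0.
  by rewrite mxE (negPf ji) eq_sym (negPf kj) scale0r.
Qed.

Lemma aff_perm n (K : fieldType) (s : {perm 'I_n}) :
  exists phi : {rmorphism {mpoly K[n]} -> {mpoly K[n]}},
  [/\ forall f, affinely_equivalent f (phi f), forall c, phi c%:MP = c%:MP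
    & forall j, phi 'X_j = 'X_(s j)].
Proof.
exists (comp_mpoly (affine_forms (perm_mx s) 0)); split=> [f|c|j].
- by exists (perm_mx s), 0, 1; rewrite unitmx_perm oner_neq0 scale1r.
- exact: comp_mpolyC.
- rewrite /= comp_affineX mxE mpolyC0 addr0 (bigD1 (s j)) //= big1 => [|k kj].
    by rewrite !mxE eqxx scale1r addr0.
  by rewrite !mxE eq_sym (negPf kj) scale0r.
Qed.

Section Quadrics.
Variable K : fieldType.
Local Notation A := {poly {poly K}}.
Local Notation X := ('X_(inord 0) : {mpoly K[3]}).
Local Notation Y := ('X_(inord 1) : {mpoly K[3]}).
Local Notation Z := ('X_(inord 2) : {mpoly K[3]}).
Implicit Types a b c d e g l m n k r s t u : K.

(** The general polynomial of degree at most two in three variables. *)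
Definition quad a b c d e g l m n k : {mpoly K[3]} :=
  a%:MP * X ^+ 2 + b%:MP * Y ^+ 2 + c%:MP * Z ^+ 2 +
  d%:MP * (X * Y) + e%:MP * (X * Z) + g%:MP * (Y * Z) +
  l%:MP * X + m%:MP * Y + n%:MP * Z + k%:MP.

Lemma rmorph_quad (S : comNzRingType) (phi : {rmorphism {mpoly K[3]} -> S}) a b c d e g l m n k :
  phi (quad a b c d e g l m n k) =
  phi a%:MP * phi X ^+ 2 + phi b%:MP * phi Y ^+ 2 + phi c%:MP * phi Z ^+ 2 +
  phi d%:MP * (phi X * phi Y) + phi e%:MP * (phi X * phi Z) + phi g%:MP * (phi Y * phi Z) +
  phi l%:MP * phi X + phi m%:MP * phi Y + phi n%:MP * phi Z + phi k%:MP.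
Proof. by rewrite /quad !(rmorphD, rmorphM, rmorphXn). Qed.

Lemma ord3_neq : [/\ inord 0 != inord 2 :> 'I_3, inord 1 != inord 2 :> 'I_3 &
  inord 0 != inord 1 :> 'I_3].
Proof. by split; rewrite inord_neq. Qed.

Lemma big_ord3 (V : nmodType) (F : 'I_3 -> V) :
  \sum_j F j = F (inord 0) + F (inord 1) + F (inord 2).
Proof.
rewrite !big_ord_recl big_ord0 addr0 addrA.
by congr (F _ + F _ + F _); apply: val_inj; rewrite /= inordK.
Qed.

Lemma quad_elem u r s t a b c d e g l m n k : u != 0 ->
  affinely_equivalent (quad a b c d e g l m n k)
    (quad (a + c * r ^+ 2 + e * r) (b + c * s ^+ 2 + g * s) (c * u ^+ 2)
      (d + 2 * c * r * s + e * s + g * r) (2 * c * r * u + e * u) (2 * c * s * u + g * u)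
      (l + 2 * c * r * t + e * t + n * r) (m + 2 * c * s * t + g * t + n * s)
      (2 * c * u * t + n * u) (k + c * t ^+ 2 + n * t)).
Proof.
move=> u0; have [n02 n12 n01] := ord3_neq.
pose R (j : 'I_3) := if j == inord 0 then r else if j == inord 1 then s else u.
have R2 : R (inord 2) = u by rewrite /R !inord_neq.
have [|phi [aff phiC phiZ phiXY]] := @aff_elem 3 K (inord 2) R t; first by rewrite R2.
have := aff (quad a b c d e g l m n k); congr affinely_equivalent.
rewrite rmorph_quad !phiC phiZ !phiXY // big_ord3 R2 /R eqxx inord_neq // eqxx.
rewrite -!mul_mpolyC /quad.
ring.
Qed.

Lemma quad_swap02 a b c d e g l m n k :
  affinely_equivalent (quad a b c d e g l m n k) (quad c b a g e d n m l k).
Proof.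
have [n02 n12 n01] := ord3_neq.
have [phi [aff phiC phiX]] := @aff_perm 3 K (tperm (inord 0) (inord 2)).
have := aff (quad a b c d e g l m n k); congr affinely_equivalent.
rewrite rmorph_quad !phiC !phiX tpermL tpermR tpermD // 1?eq_sym // /quad; ring.
Qed.

Lemma quad_swap12 a b c d e g l m n k :
  affinely_equivalent (quad a b c d e g l m n k) (quad a c b e d g l n m k).
Proof.
have [n02 n12 n01] := ord3_neq.
have [phi [aff phiC phiX]] := @aff_perm 3 K (tperm (inord 1) (inord 2)).
have := aff (quad a b c d e g l m n k); congr affinely_equivalent.
rewrite rmorph_quad !phiC !phiX tpermL tpermR tpermD // 1?eq_sym // /quad; ring.
Qed.

Lemma quad_swap01 a b c d e g l m n k :
  affinely_equivalent (quad a b c d e g l m n k) (quad b a c d g e m l n k).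
Proof.
have [n02 n12 n01] := ord3_neq.
have [phi [aff phiC phiX]] := @aff_perm 3 K (tperm (inord 0) (inord 1)).
have := aff (quad a b c d e g l m n k); congr affinely_equivalent.
rewrite rmorph_quad !phiC !phiX tpermL tpermR tpermD // 1?eq_sym // /quad; ring.
Qed.

Lemma quad_scale u a b c d e g l m n k : u != 0 ->
  affinely_equivalent (quad a b c d e g l m n k)
    (quad (u * a) (u * b) (u * c) (u * d) (u * e) (u * g) (u * l) (u * m) (u * n) (u * k)).
Proof.
move=> u0; set q := quad (u * a) _ _ _ _ _ _ _ _ _.
suff -> : quad a b c d e g l m n k = u^-1 *: q by apply: aff_scale; rewrite invr_eq0.
have -> : q = u *: quad a b c d e g l m n k.
  by rewrite /q -mul_mpolyC /quad !mpolyCM; ring.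
by rewrite scalerA mulVf // scale1r.
Qed.

End Quadrics.

Section Classification.
Variable K : fieldType.
Local Notation A := {poly {poly K}}.
Local Notation X := ('X_(inord 0) : {mpoly K[3]}).
Local Notation Y := ('X_(inord 1) : {mpoly K[3]}).
Local Notation Z := ('X_(inord 2) : {mpoly K[3]}).
Implicit Types a b c d e g l m n k r s t u : K.
Hypothesis two_neq0 : (2 : K) != 0.

Lemma aff_eq (p q : {mpoly K[3]}) : p = q -> affinely_equivalent p q.
Proof. by move=> ->; apply: aff_refl. Qed.

Lemma quad_eq a b c d e g l m n k a' b' c' d' e' g' l' m' n' k' :
  a = a' -> b = b' -> c = c' -> d = d' -> e = e' -> g = g' -> l = l' -> m = m' ->
  n = n' -> k = k' ->
  quad a b c d e g l m n k = quad a' b' c' d' e' g' l' m' n' k'.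
Proof. by do 10!move=> ->. Qed.

(** Completing the square removes the other terms in [Z].  The coefficients of
terms not involving a variable that was not mixed with [Z] are unchanged. *)
Lemma quad_complete_z a b c d e g l m n k : c != 0 ->
  exists a' b' d' l' m' k', [/\ e = 0 -> [/\ a' = a, d' = d & l' = l],
    g = 0 -> [/\ b' = b, d' = d & m' = m] &
    affinely_equivalent (quad a b c d e g l m n k)
      (quad a' b' c d' 0 0 l' m' 0 k')].
Proof.
move=> c0.
have := quad_elem (- e / (2 * c)) (- g / (2 * c)) (- n / (2 * c)) a b c d e g l m n k (oner_neq0 K).
have -> : c * 1 ^+ 2 = c by ring.
have -> : 2 * c * (- e / (2 * c)) * 1 + e * 1 = 0 by field; rewrite c0.
have -> : 2 * c * (- g / (2 * c)) * 1 + g * 1 = 0 by field; rewrite c0.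
have -> : 2 * c * 1 * (- n / (2 * c)) + n * 1 = 0 by field; rewrite c0.
move=> h; do 6!eexists; split; last exact: h.
all: move=> ->; split; rewrite ?oppr0 ?mul0r; ring.
Qed.

(** The quadratic polynomial
[b Y^2 + d X Y + m Y + a X^2 + l X + k], in Horner form. *)
Definition hpoly b d m a l k : A :=
  (b%:P%:P * 'X + (d%:P * 'X + m%:P)%:P) * 'X + ((a%:P * 'X + l%:P) * 'X + k%:P)%:P.

Lemma emb_MYadd (p : A) q : emb (p * 'X + q%:P) = emb p * Y + emb q%:P.
Proof. by rewrite [LHS]evMXaddC [emb q%:P]evC. Qed.

Lemma emb_MXadd (p : {poly K}) c : emb (p * 'X + c%:P)%:P = emb p%:P * X + c%:MP.
Proof. by rewrite [LHS]evC /= evMXaddC [emb p%:P]evC. Qed.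

Lemma emb_hpoly b d m a l k : emb (hpoly b d m a l k) =
  (b%:MP * Y + (d%:MP * X + m%:MP)) * Y + ((a%:MP * X + l%:MP) * X + k%:MP).
Proof. by rewrite /hpoly !emb_MYadd !emb_MXadd !embC. Qed.

(** The equations for which the lexicographic degree, with [Y] first, provides a
chain of three primes. *)
Definition good (f : {mpoly K[3]}) := exists h : A,
  norm_dom (poly_le (poly_le (@triv_le K))) h /\
  affinely_equivalent f (Z ^+ 2 - emb h).

Lemma good_aff (p q : {mpoly K[3]}) : affinely_equivalent p q -> good q -> good p.
Proof. by move=> pq [h [hP gh]]; exists h; split=> //; apply: aff_trans gh. Qed.

Lemma quad_hpoly a b d l m k : quad a b 1 d 0 0 l m 0 k =
  Z ^+ 2 - emb (hpoly (- b) (- d) (- m) (- a) (- l) (- k)).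
Proof. by rewrite emb_hpoly /quad; ring. Qed.

Definition nonsquare (a : K) := forall s, s ^+ 2 <> a.

Lemma norm_dom_nonsquare a : nonsquare a -> norm_dom (@triv_le K) a.
Proof.
move=> aP; apply: norm_dom_triv => p q e; have [q0|q0] := eqVneq q 0.
  by apply/eqP; rewrite -sqrf_eq0 e q0 expr0n mulr0.
by case: (aP (p / q)); rewrite expr_div_n e mulfK // expf_neq0.
Qed.

Lemma norm_dom_nonsquareC a : nonsquare a -> norm_dom (poly_le (@triv_le K)) a%:P.
Proof.
move=> aP; apply: norm_dom_poly => [|_]; first exact: triv_dominance.
by rewrite lead_coefC; apply: norm_dom_nonsquare.
Qed.

Let degP := poly_dominance (@triv_dominance K).

Lemma good_hpoly a b d l m k :
  norm_dom (poly_le (poly_le (@triv_le K))) (hpoly (- b) (- d) (- m) (- a) (- l) (- k)) ->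
  good (quad a b 1 d 0 0 l m 0 k).
Proof. by move=> NC; eexists; split; [exact: NC|rewrite quad_hpoly; apply: aff_refl]. Qed.

(** Here [h] has degree one in [Y]. *)
Lemma good_linear a d l m k : (d != 0) || (m != 0) -> good (quad a 0 1 d 0 0 l m 0 k).
Proof.
move=> dm; apply/good_hpoly/norm_dom_poly; first exact: degP.
rewrite /hpoly oppr0 mul0r add0r.
have p0 : (- d)%:P * 'X + (- m)%:P != 0.
  apply: contraTneq dm => /polyP e; have := e 0%N; have := e 1%N.
  rewrite !coefD !coefMX !coefC /= addr0 add0r => /eqP + /eqP.
  by rewrite !oppr_eq0 => -> ->.
by rewrite size_MXaddC polyC_eq0 (negPf p0) /= size_polyC p0.
Qed.

(** Here [h] has degree two in [Y], with a leading coefficient that is a scalar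
and not a square. *)
Lemma good_nonsquare a b d l m k : nonsquare (- b) -> good (quad a b 1 d 0 0 l m 0 k).
Proof.
move=> bP; have b0 : - b != 0.
  by apply/eqP => b0; apply: (bP 0); rewrite b0 expr0n.
apply/good_hpoly/norm_dom_poly => [|_]; first exact: degP.
suff -> : lead_coef (hpoly (- b) (- d) (- m) (- a) (- l) (- k)) = (- b)%:P.
  exact: norm_dom_nonsquareC.
have bC : (- b)%:P%:P != 0 :> A by rewrite !polyC_eq0.
have p0 : (- b)%:P%:P * 'X + ((- d)%:P * 'X + (- m)%:P)%:P != 0 :> A.
  by rewrite -size_poly_eq0 size_MXaddC (negPf bC) andFb.
rewrite lead_coefE /hpoly size_MXaddC (negPf p0) andFb size_MXaddC (negPf bC) andFb.
by rewrite size_polyC polyC_eq0 b0 coefD coefMX coefD coefMX !coefC /= !addr0.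
Qed.

Lemma good_const k : nonsquare (- k) -> good (quad 0 0 1 0 0 0 0 0 0 k).
Proof.
move=> kP; apply/good_hpoly/norm_dom_poly => [|_]; first exact: degP.
rewrite /hpoly !oppr0 !(polyC0, mul0r, add0r) lead_coefC.
exact: norm_dom_nonsquareC.
Qed.

(** [Z + w] vanishes at [Z = - w]. *)
Lemma Z_emb_nonunit w : Z + emb w \isn't a GRing.unit.
Proof.
pose root : {rmorphism {mpoly K[3]} -> A} := horner_eval (- w) \o @unemb K.
have root0 : root (Z + emb w) = 0.
  rewrite rmorphD /root /= unemb_emb unembX /unemb_var !inord_neq //.
  by rewrite /horner_eval hornerX hornerC addNr.
by apply/negP => /(rmorph_unit root); rewrite root0 unitr0.
Qed.

Variable f : {mpoly K[3]}.
Hypothesis f_irr : irreducible_elt f.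

Lemma irr_not_prod w w' : ~ affinely_equivalent f ((Z + emb w) * (Z + emb w')).
Proof.
by move/(aff_irreducible f_irr)/(_ erefl) => []; apply/negP/Z_emb_nonunit.
Qed.

Lemma XY_sub_1E : XY_sub_1 K = quad 0 0 0 1 0 0 0 0 0 (-1).
Proof. by rewrite /XY_sub_1 /quad; ring. Qed.

(** If [- b] is not a square, the equation is already of the right form.
Otherwise, after completing the square in [Y], it reads
[(Z - s Y) * (Z + s Y) + a' X ^+ 2 + l' X + k' = 0].  If [a'] is nonzero, the
square to be isolated is that of [X], since the product becomes linear in each
of its factors.  If [a'] vanishes but [l'] does not, the equation is linear in
[X], which is then exchanged with [Y].  If both vanish, it is a product when
[k' = 0] and is affinely [XY = 1] otherwise. *)
Lemma classify_square a b d l m k : b != 0 ->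
  affinely_equivalent f (quad a b 1 d 0 0 l m 0 k) ->
  good f \/ affinely_equivalent f (XY_sub_1 K).
Proof.
move=> b0 fq; case: (pselect (nonsquare (- b))) => [bP|].
  by left; apply: good_aff fq (good_nonsquare _ _ _ _ _ bP).
move=> /existsNP[s /contrapT bs].
have [s0 bE] : s != 0 /\ b = - s ^+ 2.
  rewrite bs opprK; split=> //; apply: contraNneq b0 => s0.
  by rewrite -[b]opprK -bs s0 expr0n oppr0.
have {fq} [a' [l' [k' fq]]] : exists a' l' k', affinely_equivalent f (quad a' b 1 0 0 0 l' 0 0 k').
  have [a' [b' [d' [l' [m' [k' [_ /(_ erefl) [-> -> ->] q]]]]]]] :=
    quad_complete_z a 1 0 d 0 l 0 m k b0.
  exists a', l', k'.
  apply: aff_trans (aff_trans fq (quad_swap12 _ _ _ _ _ _ _ _ _ _)) _.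
  exact: aff_trans q (quad_swap12 _ _ _ _ _ _ _ _ _ _).
have elim_y c l0 : affinely_equivalent (quad c b 1 0 0 0 l0 0 0 k')
    (quad c 0 1 0 0 (2 * s) l0 0 0 k').
  apply: aff_trans (quad_elem 0 s 0 _ _ _ _ _ _ _ _ _ _ (oner_neq0 K)) _.
  by apply/aff_eq/quad_eq; rewrite ?bE; ring.
have s20 : 2 * s != 0 by rewrite mulf_neq0.
have [a0|a0] := eqVneq a' 0; last first.
  left; apply: good_aff (aff_trans fq (elim_y _ _)) _.
  apply: good_aff (quad_swap02 _ _ _ _ _ _ _ _ _ _) _.
  have [a1 [b1 [d1 [l1 [m1 [k1 [/(_ erefl) [-> _ ->] /(_ erefl) [-> -> ->] q]]]]]]] :=
    quad_complete_z 1 0 (2 * s) 0 0 0 0 l' k' a0.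
  apply: good_aff q _.
  have a0' : a'^-1 != 0 by rewrite invr_eq0.
  apply: good_aff (quad_scale _ _ _ _ _ _ _ _ _ _ a0') _.
  rewrite mulVf // !mulr0; apply: good_linear.
  by rewrite mulf_neq0.
rewrite a0 in fq; have [l0|l0] := eqVneq l' 0; last first.
  left; apply: good_aff (aff_trans fq (quad_swap01 _ _ _ _ _ _ _ _ _ _)) _.
  by apply: good_linear; rewrite l0 orbT.
rewrite l0 in fq; have [k0|k0] := eqVneq k' 0.
  case: (irr_not_prod (w := s%:P%:P * 'X + 0%:P%:P)
    (w' := (- s)%:P%:P * 'X + 0%:P%:P)); apply: (aff_trans fq).
  rewrite !emb_MYadd !embC mpolyC0 !addr0 k0 bE.
  suff -> : quad 0 (- s ^+ 2) 1 0 0 0 0 0 0 0 = (Z + s%:MP * Y) * (Z + (- s)%:MP * Y).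
    exact: aff_refl.
  by rewrite /quad; ring.
right; apply: aff_trans fq (aff_trans (elim_y _ _) _).
apply: aff_trans (quad_swap12 _ _ _ _ _ _ _ _ _ _) _.
have u0 : - k' / (2 * s) != 0 by rewrite mulf_neq0 ?oppr_eq0 ?invr_eq0.
(* The substitution turns [Y ^+ 2 + 2 s Y Z + k'] into [- k' (Y Z - 1)]. *)
apply: aff_trans (quad_elem 0 (- (2 * s)^-1) 0 _ _ _ _ _ _ _ _ _ _ u0) _.
apply: aff_trans (quad_swap02 _ _ _ _ _ _ _ _ _ _) _.
have k0' : - k'^-1 != 0 by rewrite oppr_eq0 invr_eq0.
apply: aff_trans (quad_scale _ _ _ _ _ _ _ _ _ _ k0') _.
rewrite XY_sub_1E.
by apply/aff_eq/quad_eq; field; rewrite ?k0 ?s0 ?two_neq0.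
Qed.

Lemma classify_reduced a b d l m k :
  affinely_equivalent f (quad a b 1 d 0 0 l m 0 k) ->
  good f \/ affinely_equivalent f (XY_sub_1 K).
Proof.
move=> fq; have [b0|b0] := eqVneq b 0; last exact: classify_square fq.
rewrite b0 in fq; case dm : ((d != 0) || (m != 0)).
  by left; apply: good_aff fq (good_linear _ _ _ dm).
move/negbT: dm; rewrite negb_or !negbK => /andP[/eqP d0 /eqP m0].
rewrite d0 m0 in fq.
have fq' := aff_trans fq (quad_swap01 _ _ _ _ _ _ _ _ _ _).
have [a0|a0] := eqVneq a 0; last exact: classify_square fq'.
rewrite a0 in fq fq'; have [l0|l0] := eqVneq l 0; last first.
  by left; apply: good_aff fq' _; apply: good_linear; rewrite l0 orbT.
rewrite l0 in fq; left; case: (pselect (nonsquare (- k))) => [kP|].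
  by apply: good_aff fq _; apply: good_const.
move=> /existsNP[s /contrapT ks].
case: (irr_not_prod (w := s%:P%:P) (w' := (- s)%:P%:P)); apply: (aff_trans fq).
rewrite !embC -[k]opprK -ks.
suff -> : quad 0 0 1 0 0 0 0 0 0 (- s ^+ 2) = (Z + s%:MP) * (Z + (- s)%:MP).
  exact: aff_refl.
by rewrite /quad; ring.
Qed.

Lemma classify_z a b c d e g l m n k : c != 0 ->
  affinely_equivalent f (quad a b c d e g l m n k) ->
  good f \/ affinely_equivalent f (XY_sub_1 K).
Proof.
move=> c0 fq.
have [a' [b' [d' [l' [m' [k' [_ _ q]]]]]]] := quad_complete_z a b d e g l m n k c0.
have cV : c^-1 != 0 by rewrite invr_eq0.
have := aff_trans (aff_trans fq q) (quad_scale _ _ _ _ _ _ _ _ _ _ cV).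
by rewrite mulVf // !mulr0 => /classify_reduced.
Qed.

(** An exchange of variables, preceded by a shear when only mixed quadratic terms
occur, makes the coefficient of [Z ^+ 2] nonzero. *)
Lemma classify a b c d e g l m n k :
  ~~ [&& a == 0, b == 0, c == 0, d == 0, e == 0 & g == 0] ->
  affinely_equivalent f (quad a b c d e g l m n k) ->
  good f \/ affinely_equivalent f (XY_sub_1 K).
Proof.
have [c0|/classify_z h _] := eqVneq c 0; last exact: h.
have [a0|a0] := eqVneq a 0; last first.
  by move=> _ fq; apply: classify_z a0 (aff_trans fq (quad_swap02 _ _ _ _ _ _ _ _ _ _)).
have [b0|b0] := eqVneq b 0; last first.
  by move=> _ fq; apply: classify_z b0 (aff_trans fq (quad_swap12 _ _ _ _ _ _ _ _ _ _)).
rewrite a0 b0 c0 /=.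
have he e' d' g' l' m' n' : e' != 0 -> affinely_equivalent f (quad 0 0 0 d' e' g' l' m' n' k) ->
    good f \/ affinely_equivalent f (XY_sub_1 K).
  move=> e0 fq.
  have := aff_trans (aff_trans fq (quad_elem 1 0 0 _ _ _ _ _ _ _ _ _ _ (oner_neq0 K)))
    (quad_swap02 _ _ _ _ _ _ _ _ _ _).
  by apply: classify_z; rewrite !mul0r !add0r mulr1.
have [e0|e0 _] := eqVneq e 0; last exact: he.
have [d0|d0 _ fq] := eqVneq d 0; last first.
  exact: he d0 (aff_trans fq (quad_swap12 _ _ _ _ _ _ _ _ _ _)).
move=> /= g0 fq.
exact: he g0 (aff_trans fq (quad_swap01 _ _ _ _ _ _ _ _ _ _)).
Qed.

End Classification.

(** * Quadratic polynomials and the theorem *)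

Section QuadraticPolynomials.
Variable K : fieldType.
Local Notation X := ('X_(inord 0) : {mpoly K[3]}).
Local Notation Y := ('X_(inord 1) : {mpoly K[3]}).
Local Notation Z := ('X_(inord 2) : {mpoly K[3]}).

Definition is_quad (f : {mpoly K[3]}) := exists a b c d e g l m n k,
  f = quad a b c d e g l m n k.

Lemma quad_add p q : is_quad p -> is_quad q -> is_quad (p + q).
Proof.
move=> [a [b [c [d [e [g [l [m [n [k ->]]]]]]]]]].
move=> [a' [b' [c' [d' [e' [g' [l' [m' [n' [k' ->]]]]]]]]]].
exists (a + a'), (b + b'), (c + c'), (d + d'), (e + e'), (g + g'), (l + l'),
  (m + m'), (n + n'), (k + k'); rewrite /quad; ring.
Qed.

Lemma quad_scaleP (u : K) p : is_quad p -> is_quad (u *: p).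
Proof.
move=> [a [b [c [d [e [g [l [m [n [k ->]]]]]]]]]].
exists (u * a), (u * b), (u * c), (u * d), (u * e), (u * g), (u * l),
  (u * m), (u * n), (u * k); rewrite -mul_mpolyC /quad; ring.
Qed.

Lemma quad_monomial (i j k : nat) : (i + j + k <= 2)%N -> is_quad (X ^+ i * Y ^+ j * Z ^+ k).
Proof.
case: i => [|[|[|i]]]; case: j => [|[|[|j]]]; case: k => [|[|[|k]]] // _.
- exists 0,0,0,0,0,0,0,0,0,1; rewrite /quad; ring.
- exists 0,0,0,0,0,0,0,0,1,0; rewrite /quad; ring.
- exists 0,0,1,0,0,0,0,0,0,0; rewrite /quad; ring.
- exists 0,0,0,0,0,0,0,1,0,0; rewrite /quad; ring.
- exists 0,0,0,0,0,1,0,0,0,0; rewrite /quad; ring.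
- exists 0,1,0,0,0,0,0,0,0,0; rewrite /quad; ring.
- exists 0,0,0,0,0,0,1,0,0,0; rewrite /quad; ring.
- exists 0,0,0,0,1,0,0,0,0,0; rewrite /quad; ring.
- exists 0,0,0,1,0,0,0,0,0,0; rewrite /quad; ring.
- exists 1,0,0,0,0,0,0,0,0,0; rewrite /quad; ring.
Qed.

Lemma quad_exists (f : {mpoly K[3]}) : (msize f <= 3)%N -> is_quad f.
Proof.
move=> f3; rewrite [f]mpolyE big_seq.
apply: (big_ind is_quad) => [|p q|m mf]; last 1 first.
- apply: quad_scaleP; rewrite -mmap1_id /mmap1.
  have := leq_trans (msize_mdeg_lt mf) f3; rewrite ltnS mdegE.
  rewrite !big_ord_recl !big_ord0 addn0 mulr1 addnA mulrA => h.
  have e0 : ord0 = inord 0 :> 'I_3 by apply: val_inj; rewrite /= inordK.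
  have e1 : lift ord0 ord0 = inord 1 :> 'I_3 by apply: val_inj; rewrite /= inordK.
  have e2 : lift ord0 (lift ord0 ord0) = inord 2 :> 'I_3.
    by apply: val_inj; rewrite /= inordK.
  by move: h; rewrite e2 e1 e0; apply: quad_monomial.
- by exists 0,0,0,0,0,0,0,0,0,0; rewrite /quad; ring.
- exact: quad_add.
Qed.

(** Without its quadratic part the polynomial has degree at most one. *)
Lemma quad_deg2 a b c d e g l m n k : msize (quad a b c d e g l m n k : {mpoly K[3]}) = 3%N ->
  ~~ [&& a == 0, b == 0, c == 0, d == 0, e == 0 & g == 0].
Proof.
move=> s3; apply: contraTN (erefl true) => /and5P[/eqP a0 /eqP b0 /eqP c0 /eqP d0].
case/andP => /eqP e0 /eqP g0; have : (msize (quad a b c d e g l m n k) <= 2)%N.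
  rewrite a0 b0 c0 d0 e0 g0 /quad !mpolyC0 !mul0r !add0r !mul_mpolyC.
  have le1 (u : K) i : (msize (u *: 'X_i : {mpoly K[3]}) <= 2)%N.
    by rewrite (leq_trans (msizeZ_le _ _)) // msizeX mdeg1.
  have leD (p q : {mpoly K[3]}) :
      (msize p <= 2)%N -> (msize q <= 2)%N -> (msize (p + q) <= 2)%N.
    by move=> ? ?; rewrite (leq_trans (msizeD_le _ _)) // geq_max; apply/andP.
  by apply: (leD); [do 2!(apply: (leD); last exact: le1)|rewrite msizeC; case: eqP].
by rewrite s3.
Qed.

(** [X Z - 1] becomes [Z ^+ 2 - (X / 2) ^+ 2 - 1] through
[X Z = (Z' + X' / 2) * (Z' - X' / 2)]. *)
Lemma hyperbolic_cylinder : (2 : K) != 0 -> exists2 c : {poly K}, c + c = 'X &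
  affinely_equivalent (XY_sub_1 K) (Z ^+ 2 - emb (c ^+ 2 + 1)%:P).
Proof.
move=> two; exists ((2^-1)%:P * 'X).
  by rewrite -mulrDl -polyCD -mulr2n -[_ *+ 2]mulr_natr mulVf // mul1r.
rewrite XY_sub_1E; apply: aff_trans (quad_swap12 _ _ _ _ _ _ _ _ _ _) _.
apply: aff_trans (quad_elem 1 0 0 _ _ _ _ _ _ _ _ _ _ (oner_neq0 K)) _.
apply: aff_trans (quad_swap02 _ _ _ _ _ _ _ _ _ _) _.
apply: aff_trans (quad_elem (- 2^-1) 0 0 _ _ _ _ _ _ _ _ _ _ (oner_neq0 K)) _.
apply: aff_eq; transitivity (quad (- (2^-1 ^+ 2)) 0 1 0 0 0 0 0 0 (-1) : {mpoly K[3]}).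
  by apply: quad_eq; field; rewrite ?two.
rewrite quad_hpoly; congr (_ - emb _).
rewrite /hpoly !oppr0 !opprK !(polyC0, mul0r, add0r, addr0); congr (_%:P).
by rewrite polyC_exp; ring.
Qed.

End QuadraticPolynomials.

Theorem mainTheorem3 (K : fieldType) (char_neq2 : 2%N \notin [pchar K])
    (f : {mpoly K[3]}) (f_irr : irreducible_elt f) (f_deg2 : msize f = 3%N) :
  (~ affinely_equivalent f (XY_sub_1 K) ->
     krull_dim_is (recip_complement (coord_ring f_irr)) 2) /\
  (affinely_equivalent f (XY_sub_1 K) ->
     krull_dim_is (recip_complement (coord_ring f_irr)) 1).
Proof.
have two : (2 : K) != 0 by apply: contraNneq char_neq2 => two; apply/andP; rewrite two.
split=> [nXY|fXY].
- have [|a [b [c [d [e [g [l [m [n [k fE]]]]]]]]]] := quad_exists (f := f).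
    by rewrite f_deg2.
  have nz := f_deg2; rewrite fE in nz; have {}nz := quad_deg2 nz.
  have [[h [NC fh]]|//] := classify two f_irr nz (aff_eq fE).
  have [iota [z H]] := coord_ring_presentation f_irr fh.
  exact: krull_dim2 H NC.
- have [c cX h] := hyperbolic_cylinder two.
  have [iota [z H]] := coord_ring_presentation f_irr (aff_trans fXY h).
  exact (krull_dim1 H cX erefl).
Qed.
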